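(* Let $G$ be a DMG and denote by $P=\mathcal{P}_{\mathrm{FCI}}(\mathrm{IM}_\sigma(G))$ the corresponding complete DPAG output by FCI. Let $i\neq j$ be two nodes in $P$. If $j\in\mathrm{sc}_G(i)$, then $i\circ\!\!-\!\!\circ j$ in $P$, and for all nodes $k$: $k\to i$ in $P$ iff $k\to j$ in $P$, and $k\leftrightarrow i$ in $P$ iff $k\leftrightarrow j$ in $P$, and $k\circ\!\!\to i$ in $P$ iff $k\circ\!\!\to j$ in $P$.
   Context: DMGs. A directed mixed graph (DMG) $G=\langle V,E,F\rangle$ has a finite node set $V$, directed edges $i\to j$ and bidirected edges $i\leftrightarrow j$ between distinct nodes; several edges between two nodes are allowed (at most one of each of $i\to j$, $i\leftarrow j$, $i\leftrightarrow j$). A walk is an alternating sequence of nodes and edges, each edge connecting consecutive nodes; a path is a walk containing each node at most once. $\mathrm{an}_G(j)$ is the set of nodes $i$ with a (possibly trivial) directed path $i\to\dots\to j$; $\mathrm{de}_G(i)=\{j:i\in\mathrm{an}_G(j)\}$; $\mathrm{sc}_G(i)=\mathrm{an}_G(i)\cap\mathrm{de}_G(i)$ is the strongly connected component of $i$; $\mathrm{an}_G(I)=\bigcup_{i\in I}\mathrm{an}_G(i)$. An ADMG is a DMG without directed cycles. A non-endpoint node on a walk is a collider if both adjacent walk edges have an arrowhead at it; other nodes on it are non-colliders. $\sigma$-separation. A walk is $\sigma$-blocked by $C\subseteq V$ if: its first or last node is in $C$; or it contains a collider not in $\mathrm{an}_G(C)$; or it contains a non-endpoint non-collider $k\in C$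 with a directed walk edge $k\to l$ to a neighbouring node $l$ on the walk with $l\notin\mathrm{sc}_G(k)$. $A$ is $\sigma$-separated from $B$ by $C$ if all paths between nodes of $A$ and nodes of $B$ are $\sigma$-blocked by $C$. $\mathrm{IM}_\sigma(G)$ is the set of triples $\langle A,B,C\rangle$ of subsets of $V$ such that $A$ is $\sigma$-separated from $B$ by $C$. DPAGs. A directed partial ancestral graph (DPAG) is a mixed graph with edges of types $\to,\leftarrow,\leftrightarrow,\circ\!\!\to,\leftarrow\!\!\circ,\circ\!\!-\!\!\circ$, at most one edge between two distinct nodes, no self-cycles, no directed cycle and no almost directed cycle (directed path from $i$ to $j$ together with $j\leftrightarrow i$), and no inducing path between non-adjacent nodes (a path all of whose non-endpoint nodes are colliders on it and ancestors, via directed paths, of an endpoint). $*$ stands for any edge mark. A path $v_0,\dots,v_n$ is possibly directed from $v_0$ to $v_n$ if each edge between $v_{m-1}$ and $v_m$ is $v_{m-1}\circ\!\!-\!\!\circ v_m$, $v_{m-1}\circ\!\!\to v_m$ or $v_{m-1}\to v_m$; it is uncovered if $v_{m-2},v_m$ are non-adjacent for $m=2,\dots,n$. FCI (without selection bias). $\mathcal{P}_{\mathrm{FCI}}$ maps an independence model $I$ (set of triples of subsets of $V$) to the following graph. Skeleton: distinct $i,j$ are adjacent iff there is no $Z\subseteq V\setminus\{i,j\}$ with $\langle\{i\},\{j\},Z\rangle\in I$; for non-adjacent $i,j$, $\mathrm{SepSet}(i,j)$ is one such $Z$ (chosen by a fixed rule). All edges start as $\circ\!\!-\!\!\circ$.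 Orientation rules (Zhang 2008): R0: for every unshielded triple $\langle a,c,b\rangle$ ($a,c$ adjacent, $c,b$ adjacent, $a,b$ non-adjacent), orient $a\,*\!\!\to c\leftarrow\!\!*\,b$ iff $c\notin\mathrm{SepSet}(a,b)$. Then exhaustively R1–R4. R1: if $a\,*\!\!\to b\circ\!\!-\!\!*\,c$ with $a,c$ non-adjacent, orient $b\to c$. R2: if ($a\to b\,*\!\!\to c$ or $a\,*\!\!\to b\to c$) and $a\,*\!\!-\!\!\circ c$, orient $a\,*\!\!\to c$. R3: if $a\,*\!\!\to b\leftarrow\!\!*\,c$, $a\,*\!\!-\!\!\circ d\circ\!\!-\!\!*\,c$, $a,c$ non-adjacent and $d\,*\!\!-\!\!\circ b$, orient $d\,*\!\!\to b$. R4: if $\langle x,\dots,a,b,c\rangle$ is a discriminating path for $b$ (at least three edges, $x,c$ non-adjacent, every node strictly between $x$ and $b$ is a collider on the path and a parent of $c$) and $b\circ\!\!-\!\!*\,c$, orient $b\to c$ if $b\in\mathrm{SepSet}(x,c)$ and $a\leftrightarrow b\leftrightarrow c$ otherwise. Then exhaustively R8a, R9, R10. R8a: if $a\to b\to c$ and $a\circ\!\!\to c$, orient $a\to c$. R9: if $a\circ\!\!\to c$ and there is an uncovered possibly directed path $\langle a,b,\dots,c\rangle$ with $b,c$ non-adjacent, orient $a\to c$. R10: if $a\circ\!\!\to c$, $b\to c\leftarrow d$, and there are uncovered possibly directed paths $\langle a,m_1,\dots,b\rangle$ and $\langle a,m_2,\dots,d\rangle$ with $m_1,m_2$ distinct and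 non-adjacent ($m_1=b$, $m_2=d$ allowed), orient $a\to c$. For an ADMG $H$, the output $\mathcal{P}_{\mathrm{FCI}}(\mathrm{IM}_\sigma(H))$ (for ADMGs $\sigma$-separation is $d$-separation) is known as the complete DPAG of $H$; every edge mark identifiable from the independence model is oriented in it. *)

(* Defs.v *)
From HB Require Import structures.
From mathcomp Require Import all_boot.

Set Implicit Arguments.
Unset Strict Implicit.
Unset Printing Implicit Defensive.

Record DMG (V : finType) := MkDMG {
  dir : rel V;
  bidir : rel V;
  dir_irrefl : irreflexive dir;
  bidir_irrefl : irreflexive bidir;
  bidir_sym : symmetric bidir
}.

Section Ancestors.
Variables (V : finType) (G : DMG V).

Definition an (j : V) : {set V} := [set i | connect (dir G) i j].
Definition de (i : V) : {set V} := [set j | i \in an j].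
Definition sc (i : V) : {set V} := an i :&: de i.
Definition anS (I : {set V}) : {set V} := \bigcup_(i in I) an i.

End Ancestors.

(* How a walk crosses an edge from u to the next node v:
   [Fwd] is u --> v, [Bwd] is u <-- v, [Bi] is u <-> v.  *)
Inductive step := Fwd | Bwd | Bi.

Definition head_at_source (e : step) : bool := if e is Fwd then false else true.
Definition head_at_target (e : step) : bool := if e is Bwd then false else true.
Definition is_fwd (e : step) : bool := if e is Fwd then true else false.
Definition is_bwd (e : step) : bool := if e is Bwd then true else false.

Section SigmaSeparation.
Variables (V : finType) (G : DMG V).

Definition has_edge (u : V) (e : step) (v : V) : bool :=
  match e with
  | Fwd => dir G u v
  | Bwd => dir G v u
  | Bi => bidir G u v
  end.

(* A walk is its first node [u] together with the list [w] of the edges crossed,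
   each paired with the node it leads to. *)
Fixpoint is_walk (u : V) (w : seq (step * V)) : bool :=
  if w is (e, v) :: w' then has_edge u e v && is_walk v w' else true.

Definition walk_nodes (u : V) (w : seq (step * V)) : seq V := u :: unzip2 w.
Definition walk_last (u : V) (w : seq (step * V)) : V := last u (unzip2 w).

Definition is_path (u : V) (w : seq (step * V)) : bool :=
  is_walk u w && uniq (walk_nodes u w).

(* The segment u -e1- k -e2- l blocks the walk at its middle node k. *)
Definition blocking (C : {set V}) (u : V) (e1 : step) (k : V) (e2 : step) (l : V)
    : bool :=
  if head_at_target e1 && head_at_source e2 then k \notin anS G C
  else (k \in C) && ((is_bwd e1 && (u \notin sc G k))
                     || (is_fwd e2 && (l \notin sc G k))).

Fixpoint blocked_inside (C : {set V}) (u : V) (w : seq (step * V)) : bool :=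
  if w is (e1, k) :: w' then
    (if w' is (e2, l) :: _ then blocking C u e1 k e2 l else false)
    || blocked_inside C k w'
  else false.

Definition sigma_blocked (C : {set V}) (u : V) (w : seq (step * V)) : bool :=
  [|| u \in C, walk_last u w \in C | blocked_inside C u w].

Definition sigma_separated (A B C : {set V}) : Prop :=
  forall (u : V) (w : seq (step * V)),
    is_path u w -> u \in A -> walk_last u w \in B -> sigma_blocked C u w.

End SigmaSeparation.

Definition indep_model (V : finType) := {set V} -> {set V} -> {set V} -> Prop.

Definition IM_sigma (V : finType) (G : DMG V) : indep_model V :=
  sigma_separated G.

Inductive mark := Tail | Arrow | Circle.

Definition mark_eqb (m n : mark) : bool :=
  match m, n with
  | Tail, Tail | Arrow, Arrow | Circle, Circle => true
  | _, _ => false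
  end.
Lemma mark_eqP : Equality.axiom mark_eqb.
Proof. by case; case; constructor. Qed.
HB.instance Definition _ := hasDecEq.Build mark mark_eqP.

(* [P (u, v)] is the mark at the SECOND node v of the edge between u and v,
   and [None] when u and v are not adjacent. *)
Definition marked_graph (V : finType) := {ffun V * V -> option mark}.

Section MarkedGraphs.
Variables (V : finType) (P : marked_graph V).

Definition adj (a b : V) : bool := P (a, b) != None.
Definition nonadj (a b : V) : bool := (a != b) && ~~ adj a b.

Definition arrow_at (a b : V) : bool := P (a, b) == Some Arrow.   (* a *-> b *)
Definition circle_at (a b : V) : bool := P (a, b) == Some Circle. (* a *-o b *)
Definition tail_at (a b : V) : bool := P (a, b) == Some Tail.     (* a *-- b *)

Definition directed (a b : V) : bool := tail_at b a && arrow_at a b.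
Definition bidirected (a b : V) : bool := arrow_at b a && arrow_at a b.
Definition circle_arrow (a b : V) : bool := circle_at b a && arrow_at a b.
Definition circle_circle (a b : V) : bool := circle_at b a && circle_at a b.

Fixpoint all_triples (R : V -> V -> V -> bool) (s : seq V) : bool :=
  if s is u :: s' then
    (if s' is k :: l :: _ then R u k l else true) && all_triples R s'
  else true.

Definition pd_edge (u v : V) : bool :=
  [|| circle_circle u v, circle_arrow u v | directed u v].

(* The path is [a :: s]. *)
Definition uncovered_pd_path (a : V) (s : seq V) : bool :=
  [&& uniq (a :: s), path pd_edge a s
    & all_triples (fun u _ l => nonadj u l) (a :: s)].

(* The path is <x, q, a, b, c>; it has at least three edges since a, b, c are
   listed separately from x.  The nodes strictly between x and b are exactly
   the middle nodes of the triples of <x, q, a, b>. *)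
Definition discriminating_path (x : V) (q : seq V) (a b c : V) : bool :=
  [&& uniq (x :: q ++ [:: a; b; c]),
      path adj x (q ++ [:: a; b; c]),
      nonadj x c,
      all_triples (fun u k l => arrow_at u k && arrow_at l k)
                  (x :: q ++ [:: a; b])
    & all (fun k => directed k c) (rcons q a)].

Definition set_mark (u v : V) (m : mark) : marked_graph V :=
  [ffun p => if p == (u, v) then Some m else P p].

End MarkedGraphs.

Definition orient_directed (V : finType) (P : marked_graph V) (b c : V) :=
  set_mark (set_mark P c b Tail) b c Arrow.
Definition orient_bidirected (V : finType) (P : marked_graph V) (b c : V) :=
  set_mark (set_mark P c b Arrow) b c Arrow.

Section FCI.
Variable V : finType.
Implicit Types (I : indep_model V) (P Q : marked_graph V).
Implicit Types (S : V -> V -> {set V}).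

Definition separates I (i j : V) (Z : {set V}) : Prop :=
  Z \subset ~: [set i; j] /\ I [set i] [set j] Z.

Definition is_skeleton I (e : rel V) : Prop :=
  forall i j : V, e i j <-> i != j /\ ~ exists Z, separates I i j Z.

Definition is_sepset I (e : rel V) S : Prop :=
  (forall i j : V, S i j = S j i) /\
  (forall i j : V, i != j -> ~~ e i j -> separates I i j (S i j)).

Definition circle_graph (e : rel V) : marked_graph V :=
  [ffun p => if e p.1 p.2 then Some Circle else None].

Definition R0 S P : marked_graph V :=
  [ffun p => let: (a, c) := p in
     if adj P a c && [exists b, [&& adj P c b, nonadj P a b & c \notin S a b]]
     then Some Arrow else P (a, c)].

(* One application of an orientation rule; every application replaces at least
   one circle by another mark and never creates one. *)
Inductive rule_1_4 S P : marked_graph V -> Prop :=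
| R1 (a b c : V) of
    arrow_at P a b & circle_at P c b & nonadj P a c :
    rule_1_4 S P (orient_directed P b c)
| R2 (a b c : V) of
    (directed P a b && arrow_at P b c) || (arrow_at P a b && directed P b c)
    & circle_at P a c :
    rule_1_4 S P (set_mark P a c Arrow)
| R3 (a b c d : V) of
    arrow_at P a b & arrow_at P c b & circle_at P a d & circle_at P c d
    & nonadj P a c & circle_at P d b :
    rule_1_4 S P (set_mark P d b Arrow)
| R4_directed (x : V) (q : seq V) (a b c : V) of
    discriminating_path P x q a b c & circle_at P c b & b \in S x c :
    rule_1_4 S P (orient_directed P b c)
| R4_bidirected (x : V) (q : seq V) (a b c : V) of
    discriminating_path P x q a b c & circle_at P c b & b \notin S x c :
    rule_1_4 S P (orient_bidirected (orient_bidirected P a b) b c).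

Inductive rule_8_10 P : marked_graph V -> Prop :=
| R8a (a b c : V) of
    directed P a b & directed P b c & circle_arrow P a c :
    rule_8_10 P (orient_directed P a c)
| R9 (a b c : V) (s : seq V) of
    circle_arrow P a c & uncovered_pd_path P a (b :: s) & last b s = c
    & nonadj P b c :
    rule_8_10 P (orient_directed P a c)
| R10 (a b c d m1 m2 : V) (s1 s2 : seq V) of
    circle_arrow P a c & directed P b c & directed P d c
    & uncovered_pd_path P a (m1 :: s1) & last m1 s1 = b
    & uncovered_pd_path P a (m2 :: s2) & last m2 s2 = d
    & nonadj P m1 m2 :
    rule_8_10 P (orient_directed P a c).

Inductive exhaustively (rule : marked_graph V -> marked_graph V -> Prop) :
    marked_graph V -> marked_graph V -> Prop :=
| exhausted P of (forall Q, ~ rule P Q) : exhaustively rule P P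
| apply_rule P Q P' of rule P Q & exhaustively rule Q P' :
    exhaustively rule P P'.

(* [FCI_output I P] : P is the graph returned by FCI on I, for some choice of
   the separating sets and some order of application of the rules. *)
Definition FCI_output I P : Prop :=
  exists (e : rel V) S P',
    [/\ is_skeleton I e, is_sepset I e S,
        exhaustively (rule_1_4 S) (R0 S (circle_graph e)) P'
      & exhaustively rule_8_10 P' P].

End FCI.

(* Main.v *)
Require Import Defs.
From mathcomp Require Import all_boot.
From Stdlib Require Classical_Prop.

Set Implicit Arguments.
Unset Strict Implicit.
Unset Printing Implicit Defensive.

(** Nodes [i] and [j] of one strongly connected component have the same
    ancestors and descendants, so what has to be shown is that the algorithm
    cannot tell them apart.  The argument has two halves.

    Soundness of R0-R4 over the cyclic graph.  Two nodes are inseparable exactly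
    when an inducing walk joins them: its colliders are ancestors of an endpoint
    and its other inner nodes point only into their own component, so that no
    conditioning set blocks them.  Such a walk can be made open given any [Z]
    ([inducing_open]), and it can be chosen to enter an endpoint with an
    arrowhead whenever that endpoint is not an ancestor of the other
    ([inducing_heads]).  Concatenating these walks shows that the middle node of
    an unshielded triple lies in the separating set iff it is an ancestor of an
    outer node ([unshielded_sepset]), and likewise for discriminating paths
    ([discriminating_sepset]).  Hence an arrowhead at [b] on [a *-> b] always
    means that [b] is no ancestor of [a], and a tail at [a] on [a --> b] that
    [a] is an ancestor of [b] ([sound_rule]).  As [i] and [j] are adjacent and
    ancestors of each other, the edge between them keeps its two circles.

    Propagation of marks.  In the graph [F] where R1-R4 no longer apply,
    [a *-> b o-* c] implies [a *-> c] ([pushes_F]); this is proved by following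
    the order in which arrowheads are created.  Across [i o-o j] it moves every
    arrowhead at [i] to [j], and together with R2 it settles the mark at the other
    end, up to one question: can [k --> i] occur together with [k o-> j]?
    If R1 or R4 oriented [k --> i], then one of these rules would still apply
    to [F] ([tail_excludes_circle]).  If R8a, R9 or R10 did, then the same
    rule applies to [k o-> j] in the final graph ([directed_neighbour]); for R9
    the uncovered possibly directed path to [i] must be redirected to [j]
    ([reroute_pd_path]). *)

(** * Walks with typed ends *)

(** How an end of a walk meets the endpoint: with an arrowhead, or with a tail
    on an edge that stays in the strongly connected component of the endpoint or
    leaves it.  These three cases are all that blocking depends on. *)
Inductive walk_end := Head | TailIn | TailOut.

Definition is_head (s : walk_end) : bool := if s is Head then true else false.
Definition is_out (s : walk_end) : bool := if s is TailOut then true else false.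

Definition flip (e : step) : step :=
  match e with Fwd => Bwd | Bwd => Fwd | Bi => Bi end.

Section Walks.
Variables (V : finType) (G : DMG V).
Implicit Types (u v k l : V) (e : step) (s t : walk_end) (Z : {set V}).

Local Notation anc := (connect (dir G)).

Lemma in_sc u v : (v \in sc G u) = anc v u && anc u v.
Proof. by rewrite /sc /de /an !inE. Qed.

Lemma in_anS Z k : reflect (exists2 z, z \in Z & anc k z) (k \in anS G Z).
Proof.
apply: (iffP bigcupP) => [[z zZ]|[z zZ kz]]; first by rewrite inE; exists z.
by exists z; rewrite ?inE.
Qed.

Lemma anS_connect Z k l : anc k l -> l \in anS G Z -> k \in anS G Z.
Proof.
move=> kl /in_anS[z zZ lz]; apply/in_anS; exists z => //.
exact: connect_trans lz.
Qed.

Lemma sub_anS Z k : k \in Z -> k \in anS G Z.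
Proof. by move=> kZ; apply/in_anS; exists k. Qed.

Definition end_at u e v : walk_end :=
  if head_at_source e then Head else if v \in sc G u then TailIn else TailOut.

Lemma is_head_end u e v : is_head (end_at u e v) = head_at_source e.
Proof. by rewrite /end_at; case: e => //=; case: ifP. Qed.

Lemma flipK : involutive flip. Proof. by case. Qed.

Lemma head_flip e : head_at_source (flip e) = head_at_target e.
Proof. by case: e. Qed.

Lemma has_edge_flip u e v : has_edge G u e v -> has_edge G v (flip e) u.
Proof. by case: e => //=; rewrite bidir_sym. Qed.

(** Nonempty walks, indexed by how they meet their two endpoints; [J] is
    required at every inner node.  Walks can be concatenated as soon as [J] holds
    where they meet, without any bookkeeping on lists of edges. *)
Inductive walk (J : V -> walk_end -> walk_end -> bool) :
    V -> walk_end -> walk_end -> V -> Prop :=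
| walk_edge u e v : has_edge G u e v ->
    walk J u (end_at u e v) (end_at v (flip e) u) v
| walk_step u e k s t v : has_edge G u e k -> J k (end_at k (flip e) u) s ->
    walk J k s t v -> walk J u (end_at u e k) t v.

(** The negation of [blocking], see [not_blocking]. *)
Definition through Z k s t : bool :=
  if is_head s && is_head t then k \in anS G Z
  else (k \notin Z) || ~~ (is_out s || is_out t).

(** The condition at the inner nodes of a walk between [u] and [v] which makes
    it useless to condition on any set. *)
Definition inducing u v k s t : bool :=
  if is_head s && is_head t then anc k u || anc k v
  else ~~ (is_out s || is_out t).

Lemma throughC Z k s t : through Z k s t = through Z k t s.
Proof. by rewrite /through andbC orbC [is_out s || _]orbC orbC. Qed.

Lemma inducingC u v k s t : inducing u v k s t = inducing u v k t s.
Proof. by rewrite /inducing andbC [is_out s || _]orbC. Qed.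

Lemma walk_cat J u s t k s' t' v :
  walk J u s t k -> J k t s' -> walk J k s' t' v -> walk J u s t' v.
Proof.
elim=> {u s t k} [u e k uk Jk kv|u e l s t k ul Jl _ IH Jk kv].
  exact: walk_step kv.
by apply: walk_step Jl _ => //; apply: IH.
Qed.

Lemma walk_sub (J J' : V -> walk_end -> walk_end -> bool) u s t v :
  (forall k s t, J k s t -> J' k s t) -> walk J u s t v -> walk J' u s t v.
Proof.
move=> JJ'; elim=> {u s t v} [u e v uv|u e k s t v uk Jk _ IH].
  exact: walk_edge.
by apply: walk_step IH => //; apply: JJ'.
Qed.

Lemma walk_rev J u s t v :
  (forall k s t, J k s t = J k t s) -> walk J u s t v -> walk J v t s u.
Proof.
move=> JC; have W1 x e y : has_edge G x e y ->
    walk J y (end_at y (flip e) x) (end_at x e y) x.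
  by move=> /has_edge_flip/(walk_edge J); rewrite flipK.
elim=> {u s t v} [u e v|u e k s t v uk Jk _ IH]; first exact: W1.
by apply: walk_cat IH _ (W1 _ _ _ uk); rewrite JC.
Qed.

(** Directed walks inside a component have only harmless tails, so they fit into
    inducing walks and are open given every set. *)
Lemma walk_within_sc (J : V -> walk_end -> walk_end -> bool) k v :
    (forall l, J l Head TailIn) -> k != v -> anc k v -> anc v k ->
  walk J k TailIn Head v.
Proof.
move=> HJ + /connectP[p]; elim: p k => [k kv _ E|l p IH k kv].
  by rewrite E eqxx in kv.
move=> /= /andP[kl pl] E vk.
have lv : anc l v by apply/connectP; exists p.
have Ek : end_at k Fwd l = TailIn.
  by rewrite /end_at /= in_sc (connect_trans lv vk) (connect1 kl).
case: (eqVneq l v) => [Elv|nlv].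
  by rewrite -Elv -{1}Ek; apply: (@walk_edge J k Fwd l).
rewrite -{1}Ek; apply: (@walk_step J k Fwd l TailIn) => //.
by apply: IH => //; apply: connect_trans vk (connect1 kl).
Qed.

(** Below a node with no descendant in [Z] there is nothing that could block a
    directed walk. *)
Lemma walk_outside_anS Z k v : k != v -> anc k v -> k \notin anS G Z ->
  exists s, ~~ is_head s /\ walk (through Z) k s Head v.
Proof.
move=> + /connectP[p]; elim: p k => [k kv _ E|l p IH k kv].
  by rewrite E eqxx in kv.
move=> /= /andP[kl pl] E kZ.
have Hk : ~~ is_head (end_at k Fwd l) by rewrite is_head_end.
exists (end_at k Fwd l); split=> //.
case: (eqVneq l v) => [<-|nlv]; first exact: (@walk_edge _ k Fwd l).
have lZ : l \notin anS G Z.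
  by apply: contra kZ; apply: anS_connect; apply: connect1.
have [s [Hs W]] := IH l nlv pl E lZ.
apply: (@walk_step _ k Fwd l s) => //.
rewrite /through (negbTE Hs) andbF; apply/orP; left.
by apply: contra lZ; apply: sub_anS.
Qed.

(** A walk that leaves a descendant [k] of [v] with a tail runs along
    directed edges until its first collider [l].  Since [l] descends from [v],
    which is no ancestor of [u], it must be an ancestor of [v], hence in its
    component; coming from [l] inside that component enters [v] with an
    arrowhead. *)
Lemma inducing_into_start u v k a s w : w = u -> ~~ anc v u -> anc v k -> ~~ is_head a ->
  walk (inducing u v) k a s w -> walk (inducing u v) v Head s w.
Proof.
move=> wu vu vk Ha W.
elim: W wu vk Ha => {k a s w} [k e w kw|k e l s t w kl Jl W IH] wu vk.
  case: e kw => //= kw _; case/negP: vu; rewrite -wu.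
  exact: connect_trans vk (connect1 kw).
rewrite is_head_end; case: e kl Jl => //= kl Jl _.
have vl : anc v l by apply: connect_trans vk (connect1 kl).
case Hs: (is_head s) Jl; last by move=> _; apply: IH => //; rewrite Hs.
rewrite /inducing /= Hs => /orP[lu|lv].
  by case/negP: vu; apply: connect_trans vl lu.
have Es : s = Head by move: Hs; case: (s).
case: (eqVneq l v) => [Elv|nlv]; first by move: W; rewrite Elv Es.
have Wvl : walk (inducing u v) v Head TailIn l.
  by apply: walk_rev (inducingC u v) _; apply: walk_within_sc.
by apply: walk_cat Wvl _ W; rewrite Es.
Qed.

Lemma inducing_swap u v k s t w :
  walk (inducing u v) k s t w -> walk (inducing v u) k s t w.
Proof. by apply: walk_sub => ? ? ?; rewrite /inducing orbC. Qed.

Lemma through_noncollider Z k s t :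
  k \notin Z -> ~~ (is_head s && is_head t) -> through Z k s t.
Proof. by move=> kZ Hst; rewrite /through (negbTE Hst) kZ. Qed.

(** The part of the walk up to [k] has been made open; the rest is processed node
    by node.  A collider [l] with no descendant in [Z] is an ancestor of [u] or of
    [v].  In the first case what precedes is replaced by a directed walk read
    backwards from [l] to [u], in the second case what follows is replaced by a
    directed walk from [l] to [v]; both put an arrowhead at the endpoint concerned. *)
Lemma inducing_open_aux Z u v s k a t w :
  w = v -> u != v ->
  walk (inducing u v) k a t w ->
  (k = u /\ (is_head s -> is_head a)) \/
  (exists s' r, [/\ walk (through Z) u s' r k, through Z k r a
     & is_head s -> is_head s']) ->
  exists s' t', [/\ walk (through Z) u s' t' w, is_head s -> is_head s'
     & is_head t -> is_head t'].
Proof.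
move=> wv uv W; elim: W wv => {k a t w} [k e w kw wv|k e l a t w kl Jl W IH wv].
  case=> [[ku Ha]|[s' [r [Wk Jk Hs]]]].
    rewrite -ku; exists (end_at k e w), (end_at w (flip e) k); split=> //.
    exact: walk_edge.
  exists s', (end_at w (flip e) k); split=> //.
  exact: (walk_cat Wk Jk (walk_edge _ kw)).
move=> acc.
have {acc} [s' [Wl Hs]] : exists s',
    walk (through Z) u s' (end_at l (flip e) k) l /\ (is_head s -> is_head s').
  case: acc => [[ku Ha]|[s' [r [Wk Jk Hs]]]].
    by exists (end_at k e l); split=> //; rewrite -ku; apply: walk_edge.
  by exists s'; split=> //; apply: (walk_cat Wk Jk (walk_edge _ kl)).
have IHl := IH wv; move: Jl Wl.
set r := end_at l (flip e) k => Jl Wl.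
case Hra: (is_head r && is_head a); last first.
  apply: IHl; right; exists s', r; split=> //.
  by move: Jl; rewrite /inducing /through Hra => ->; rewrite orbT.
have /andP[Hr Ha] := Hra.
have [lZ|lZ] := boolP (l \in anS G Z).
  by apply: IHl; right; exists s', r; split=> //; rewrite /through Hra.
have lZ' : l \notin Z by apply: contra lZ; apply: sub_anS.
move: Jl; rewrite /inducing Hra => /orP[lu|lv].
  case: (eqVneq l u) => [Elu|nlu]; first by apply: IHl; left.
  have [r' [Hr' Wlu]] := walk_outside_anS nlu lu lZ.
  apply: IHl; right; exists Head, r'; split=> //.
    exact: walk_rev (throughC Z) Wlu.
  by apply: through_noncollider => //; rewrite (negbTE Hr').
case: (eqVneq l v) => [Elv|nlv].
  by exists s', r; split=> //; rewrite wv -Elv.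
have [r' [Hr' Wlv]] := walk_outside_anS nlv lv lZ.
exists s', Head; rewrite wv; split=> //.
apply: walk_cat Wl _ Wlv; apply: through_noncollider => //.
by rewrite (negbTE Hr') andbF.
Qed.

Lemma inducing_open Z u v s t : u != v -> walk (inducing u v) u s t v ->
  exists s' t', [/\ walk (through Z) u s' t' v, is_head s -> is_head s'
     & is_head t -> is_head t'].
Proof. by move=> uv W; apply: inducing_open_aux uv W _ => //; left. Qed.

Lemma inducing_heads u v s t : u != v -> walk (inducing u v) u s t v ->
  exists s' t', [/\ walk (inducing u v) u s' t' v,
     ~~ anc v u -> is_head t' & ~~ anc u v -> is_head s'].
Proof.
move=> uv W0.
have fix1 x y a b : walk (inducing x y) x a b y ->
    exists b', walk (inducing x y) x a b' y /\ (~~ anc y x -> is_head b').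
  move=> W; have [Hb|Hb] := boolP (is_head b); first by exists b.
  have [yx|yx] := boolP (anc y x); first by exists b.
  exists Head; split=> //; apply: walk_rev (inducingC x y) _.
  by apply: inducing_into_start yx _ Hb (walk_rev (inducingC x y) W).
have [t' [W1 Ht]] := fix1 _ _ _ _ W0.
have [s' [W2 Hs]] := fix1 _ _ _ _ (walk_rev (inducingC v u) (inducing_swap W1)).
exists s', t'; split=> //.
exact: walk_rev (inducingC u v) (inducing_swap W2).
Qed.

(** * From open walks to open paths *)

Definition open_inside Z u (w : seq (step * V)) : bool :=
  is_walk G u w && ~~ blocked_inside G Z u w.

Definition ok_step Z u e k (w : seq (step * V)) : bool :=
  if w is (e', l) :: _ then ~~ blocking G Z u e k e' l else true.

Lemma open_inside_cons Z u e k w :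
  open_inside Z u ((e, k) :: w) =
    [&& has_edge G u e k, ok_step Z u e k w & open_inside Z k w].
Proof.
rewrite /open_inside /ok_step /=; case: w => [|[e' l] w] /=; first by rewrite !andbT.
by rewrite negb_or -!andbA; do !bool_congr.
Qed.

Lemma open_inside_cat Z u w1 w2 : open_inside Z u (w1 ++ w2) ->
  open_inside Z (walk_last u w1) w2.
Proof.
elim: w1 u => [|[e k] w1 IH] u //=.
by rewrite open_inside_cons => /and3P[_ _ /IH].
Qed.

Lemma not_blocking Z u e k e' l :
  ~~ blocking G Z u e k e' l = through Z k (end_at k (flip e) u) (end_at k e' l).
Proof.
rewrite /blocking /through !is_head_end head_flip.
case: ifP => _; first by rewrite negbK.
rewrite negb_and; congr (_ || ~~ _).
by rewrite /end_at; case: e; case: e' => //=; do ?case: ifP.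
Qed.

Lemma open_list_walk Z u e k w : open_inside Z u ((e, k) :: w) ->
  exists t, walk (fun l s t => (l \in belast k (unzip2 w)) && through Z l s t)
    u (end_at u e k) t (walk_last k w).
Proof.
elim: w u e k => [|[e' l] w IH] u e k; rewrite open_inside_cons.
  case/and3P=> uk _ _; exists (end_at k (flip e) u); exact: walk_edge.
case/and3P=> uk + /IH[t W]; rewrite /ok_step not_blocking => T.
exists t; apply: walk_step uk _ _; last first.
  apply: walk_sub W => x a b /andP[xw ->]; rewrite andbT.
  by rewrite /= inE xw orbT.
by rewrite /= inE eqxx.
Qed.

Lemma walk_open_list Z u s t v : walk (through Z) u s t v ->
  exists e k w, [/\ open_inside Z u ((e, k) :: w), walk_last k w = v
    & s = end_at u e k].
Proof.
elim=> {u s t v} [u e v uv|u e k s t v uk Jk _ [e' [l [w [O L E]]]]].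
  by exists e, v, [::]; split; rewrite ?open_inside_cons ?uv.
exists e, k, ((e', l) :: w); split=> //.
by rewrite open_inside_cons uk O andbT /ok_step not_blocking -E.
Qed.

Lemma mem_unzip2 u (w : seq (step * V)) : u \in unzip2 w ->
  exists w1 e w2, w = w1 ++ (e, u) :: w2.
Proof.
elim: w => [|[e k] w IH] //=; rewrite inE => /orP[/eqP->|/IH].
  by exists [::], e, w.
by case=> [w1 [e' [w2 ->]]]; exists ((e, k) :: w1), e', w2.
Qed.

(** Following a loop that leaves [k] with a tail, one meets a collider, at the
    latest at the return to [u]; colliders of open walks are ancestors of [Z]. *)
Lemma tail_loop_anS Z u e e' l w2 w1 k :
  open_inside Z k (w1 ++ (e, u) :: (e', l) :: w2) -> head_at_source e' ->
  ~~ head_at_source (head (e, u) w1).1 -> k \in anS G Z.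
Proof.
elim: w1 k => [|[e1 n] w1 IH] k /=; rewrite open_inside_cons => /and3P[kn ok O] He'.
  move: ok; rewrite /ok_step not_blocking /through !is_head_end head_flip He' => + He.
  case: e He kn {O} => //= _ ku uZ; exact: anS_connect (connect1 ku) uZ.
case: e1 kn ok => //= kn ok _; apply: anS_connect (connect1 kn) _.
have [Hh|Hh] := boolP (head_at_source (head (e, u) w1).1); last exact: IH O He' Hh.
move: ok; rewrite /ok_step; case: (w1) Hh => [|[f m] w] /= Hh;
  by rewrite not_blocking /through !is_head_end Hh.
Qed.

(** Cutting a loop at [u] keeps the walk open at [u].  The only new danger is
    that [u] becomes a collider although the loop left it with a tail; then
    [tail_loop_anS] applies.  A tail that leaves the component would
    already have blocked the longer walk. *)
Lemma ok_step_cut Z x f u w1 e w2 : open_inside Z u (w1 ++ (e, u) :: w2) ->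
  ok_step Z x f u (w1 ++ (e, u) :: w2) -> ok_step Z x f u w2.
Proof.
case: w2 => [|[e' l] w2] // O.
have ok' : ok_step Z (walk_last u w1) e u ((e', l) :: w2).
  by move: O => /open_inside_cat; rewrite open_inside_cons => /and3P[].
have [e1 [n [w' Ew]]] : exists e1 n w', w1 ++ (e, u) :: (e', l) :: w2 = (e1, n) :: w'.
  by case: (w1) => [|[e1 n] w']; do 3 eexists.
have Ee1 : e1 = (head (e, u) w1).1 by move: Ew; case: (w1) => [|[? ?] ?] [].
have tail_out m : is_out (end_at u m l) -> ~~ head_at_source m.
  by rewrite -(is_head_end u m l); case: end_at.
have tail_out' m y : is_out (end_at u m y) -> ~~ head_at_source m.
  by rewrite -(is_head_end u m y); case: end_at.
rewrite Ew; move: ok'; rewrite /ok_step !not_blocking /through !is_head_end !head_flip.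
have [/andP[Hf He'] _|Hfe'] := boolP (head_at_target f && head_at_source e').
  rewrite Hf /=; case He1 : (head_at_source e1) => // _.
  by apply: (tail_loop_anS O) => //; rewrite -Ee1 He1.
case uZ: (u \in Z) => /=; last by [].
case: ifP => [/andP[_ He'] _|_].
  have -> : is_out (end_at u e' l) = false by apply/negP=> /tail_out; rewrite He'.
  rewrite orbF; case: ifP => [/andP[Hf _] _|_]; last by rewrite negb_or => /andP[].
  by apply/negP=> /tail_out'; rewrite head_flip Hf.
rewrite negb_or => /andP[_ He'].
rewrite (negbTE He') orbF; case: ifP => [/andP[Hf _] _|_]; last by rewrite negb_or => /andP[].
by apply/negP=> /tail_out'; rewrite head_flip Hf.
Qed.

(** The last conjunct lets the induction put an edge in front of the shortened
    walk. *)
Lemma loop_erasure Z u w : open_inside Z u w ->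
  exists w', [/\ open_inside Z u w', uniq (walk_nodes u w'),
    walk_last u w' = walk_last u w
    & forall x f, ok_step Z x f u w -> ok_step Z x f u w'].
Proof.
elim: w u => [|[e k] w IH] u; first by exists [::].
rewrite open_inside_cons => /and3P[uk ok /IH[w' [O U L M]]].
have O' : open_inside Z u ((e, k) :: w') by rewrite open_inside_cons uk M.
have [um|um] := boolP (u \in unzip2 ((e, k) :: w')); last first.
  exists ((e, k) :: w'); split=> //; by rewrite /walk_nodes cons_uniq um.
have [w1 [f [w2 E]]] := mem_unzip2 um.
have Ew : (e, k) :: w' = rcons w1 (f, u) ++ w2 by rewrite cat_rcons.
have Ek : k :: unzip2 w' = rcons (unzip2 w1) u ++ unzip2 w2.
  by rewrite -[_ :: _]/(unzip2 ((e, k) :: w')) Ew /unzip2 map_cat map_rcons.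
exists w2; split.
- have := O'; rewrite Ew => /open_inside_cat.
  by rewrite /walk_last /unzip2 map_rcons last_rcons.
- move: U; rewrite /walk_nodes Ek cat_rcons cat_uniq => /and3P[_ _].
  by [].
- rewrite /walk_last -[last u (unzip2 (_ :: _))]/(last u (k :: unzip2 w)).
  move: L; rewrite /walk_last /= => <-.
  by rewrite -[last k _]/(last u (k :: unzip2 w')) Ek last_cat last_rcons.
move=> x g okg; rewrite E in O'; apply: ok_step_cut O' _; rewrite -E.
by move: okg; rewrite /ok_step.
Qed.

Lemma separated_no_walk Z u v s t : sigma_separated G [set u] [set v] Z ->
  u \notin Z -> v \notin Z -> ~ walk (through Z) u s t v.
Proof.
move=> sep uZ vZ /walk_open_list[e [k [w [O L _]]]].
have [w' [O' U L' _]] := loop_erasure O.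
have Lv : walk_last u w' = v by rewrite L'.
have := sep u w'; rewrite /is_path U Lv !inE /sigma_blocked (negbTE uZ) Lv (negbTE vZ).
by case/andP: O' => -> /negbTE-> /(_ isT (eqxx _) (eqxx _)).
Qed.

(** * Inseparable nodes and inducing walks *)

Definition inseparable u v : Prop := ~ exists Z, separates (IM_sigma G) u v Z.

(** Conditioning on all other ancestors of [u] and [v] blocks every path that is
    not inducing: on an open path all nodes are ancestors of [u] or [v], so the
    inner noncolliders are conditioned on and may not leave their component. *)
Lemma inseparable_inducing u v : u != v -> inseparable u v ->
  exists s t, walk (inducing u v) u s t v.
Proof.
move=> uv insep.
pose W k := anc k u || anc k v.
pose Z := [set k | W k & k \notin [set u; v]].
have anZ k : k \in anS G Z -> W k.
  case/in_anS=> z; rewrite !inE => /andP[/orP[zu|zv] _] kz; apply/orP.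
    by left; apply: connect_trans zu.
  by right; apply: connect_trans zv.
have Wup k l : anc k l -> W l -> W k.
  by move=> kl /orP[lu|lv]; apply/orP; [left|right]; apply: connect_trans kl _.
pose J k s t := (k \notin [set u; v]) && through Z k s t.
suff [s [t W0]] : exists s t, walk J u s t v.
  have tailW k s' t' w : walk J k s' t' w -> w = v -> ~~ is_head s' -> W k.
    elim=> {k s' t' w} [k e w kw wv|k e l s' t' w kl Jl _ IH wv].
      rewrite is_head_end; case: e kw => //= kw _; rewrite /W -wv.
      by rewrite (connect1 kw) orbT.
    rewrite is_head_end; case: e kl Jl => //= kl Jl _; apply: Wup (connect1 kl) _.
    have [Hs|Hs] := boolP (is_head s'); last exact: IH.
    by case/andP: Jl => _; rewrite /through Hs /= => /anZ.
  (* Forward from a tail, the next collider or [v] puts a node in [W]; backward,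
     this information is carried along as the premise on [k]. *)
  exists s, t; suff G0 k s' t' w : walk J k s' t' w -> w = v -> (is_head s' -> W k) ->
      walk (inducing u v) k s' t' w.
    by apply: G0 W0 _ _ => // _; rewrite /W connect0.
  elim=> {k s' t' w} [k e w kw _ _|k e l s' t' w kl Jl Wl IH wv Wk].
    exact: walk_edge.
  have Hl : is_head s' -> W l.
    move=> Hs; have [He|He] := boolP (head_at_target e).
      case/andP: Jl => _; rewrite /through is_head_end head_flip He Hs /=.
      exact: anZ.
    move: Wk; rewrite is_head_end; case: e kl He {Jl} => //= kl _ Wk.
    exact: Wup (connect1 kl) (Wk isT).
  have Wl' : W l.
    by have [/Hl//|Hs] := boolP (is_head s'); apply: tailW Wl wv Hs.
  apply: walk_step (IH wv Hl) => //; case/andP: Jl => luv.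
  rewrite /through /inducing; case: ifP => // _ /orP[|->//].
  by rewrite inE luv Wl'.
apply: Classical_Prop.NNPP => noW; apply: insep; exists Z; split.
  by apply/subsetP=> k; rewrite !inE => /andP[_ ->].
move=> x w + /set1P xu /set1P wv; rewrite {x}xu in wv *.
case/andP=> isw U; apply/negPn/negP; rewrite !negb_or => /and3P[_ _ O].
case: w => [|[e k] w] in wv isw U O *.
  by move: uv; rewrite -wv /walk_last eqxx.
have /open_list_walk[t Wt] : open_inside Z u ((e, k) :: w) by rewrite /open_inside isw.
apply: noW; exists (end_at u e k), t; rewrite -wv.
apply: walk_sub Wt => l a b /andP[lw Tl]; rewrite /J Tl andbT !inE.
have {U} : uniq (u :: rcons (belast k (unzip2 w)) (last k (unzip2 w))).
  by rewrite -lastI.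
rewrite cons_uniq rcons_uniq mem_rcons inE negb_or => /and3P[/andP[_ ul] ulast _].
rewrite -wv negb_or; apply/andP; split; first by apply: contraNneq ul => <-.
by apply: contraNneq ulast => El; move: lw; rewrite El.
Qed.

Lemma inseparable_open Z u v : u != v -> inseparable u v ->
  exists s t, [/\ walk (through Z) u s t v,
     ~~ anc u v -> is_head s & ~~ anc v u -> is_head t].
Proof.
move=> uv /(inseparable_inducing uv)[s0 [t0 /(inducing_heads uv)]].
case=> [s [t [W Ht Hs]]]; have [s' [t' [W' Hs' Ht']]] := inducing_open Z uv W.
by exists s', t'; split=> // /[dup]; [move/Hs/Hs'|move/Ht/Ht'].
Qed.

Lemma inducing_inseparable u v s t : u != v ->
  walk (inducing u v) u s t v -> inseparable u v.
Proof.
move=> uv W [Z [/subsetP Zuv sep]].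
have [s' [t' [W' _ _]]] := inducing_open Z uv W.
apply: separated_no_walk sep _ _ W'.
  by apply/negP=> /Zuv; rewrite !inE eqxx.
by apply/negP=> /Zuv; rewrite !inE eqxx orbT.
Qed.

Lemma inseparable_sym u v : u != v -> inseparable u v -> inseparable v u.
Proof.
move=> uv /(inseparable_inducing uv)[s [t W]].
apply: (@inducing_inseparable _ _ t s); first by rewrite eq_sym.
exact: walk_rev (inducingC v u) (inducing_swap W).
Qed.

Lemma inseparable_sc u v : u != v -> anc u v -> anc v u -> inseparable u v.
Proof.
move=> uv u_v v_u; apply: (@inducing_inseparable _ _ TailIn Head) => //.
exact: walk_within_sc.
Qed.

(** An inducing walk that enters [b] with an arrowhead can be prolonged inside the
    component of [b].  This replaces the acyclicity on which the soundness of R1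
    usually rests. *)
Lemma inseparable_sc_trans a b c : a != b -> inseparable a b -> ~~ anc b a ->
  anc b c -> anc c b -> inseparable a c.
Proof.
move=> ab insep ba b_c c_b.
have ac : a != c by apply: contraNneq ba => ->.
have [s0 [t0 /(inducing_heads ab)[s [t [W Ht _]]]]] := inseparable_inducing ab insep.
have Et : t = Head by move: (Ht ba); case: (t).
have W' : walk (inducing a c) a s t b.
  apply: walk_sub W => k x y; rewrite /inducing; case: ifP => // _ /orP[->//|kb].
  by rewrite (connect_trans kb b_c) orbT.
case: (eqVneq b c) => [<- //|bc].
apply: (@inducing_inseparable _ _ s Head) => //; apply: walk_cat W' _ _; last first.
  exact: walk_within_sc.
by rewrite Et.
Qed.

End Walks.

(** * Marks and discriminating paths *)

Section Marks.
Variable V : finType.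
Implicit Types (P Q : marked_graph V) (a b c : V).

Lemma adj_mark P a b :
  adj P a b = [|| arrow_at P a b, circle_at P a b | tail_at P a b].
Proof. by rewrite /adj /arrow_at /circle_at /tail_at; case: (P _) => [[]|]. Qed.

Lemma arrow_not_circle P a b : arrow_at P a b -> ~~ circle_at P a b.
Proof. by rewrite /arrow_at /circle_at => /eqP->. Qed.

Lemma circle_not_arrow P a b : circle_at P a b -> ~~ arrow_at P a b.
Proof. by apply: contraTN => /arrow_not_circle. Qed.

Lemma tail_not_circle P a b : tail_at P a b -> ~~ circle_at P a b.
Proof. by rewrite /tail_at /circle_at => /eqP->. Qed.

Lemma arrow_adj P a b : arrow_at P a b -> adj P a b.
Proof. by rewrite adj_mark => ->. Qed.

Lemma circle_adj P a b : circle_at P a b -> adj P a b.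
Proof. by rewrite adj_mark => -> /=; rewrite orbT. Qed.

Definition refines P Q : Prop := forall p, P p != Some Circle -> Q p = P p.

Lemma refines_trans P Q R : refines P Q -> refines Q R -> refines P R.
Proof. by move=> PQ QR p Pp; rewrite QR PQ. Qed.

Lemma refines_arrow P Q a b : refines P Q -> arrow_at P a b -> arrow_at Q a b.
Proof. by rewrite /arrow_at => PQ /eqP E; rewrite PQ E. Qed.

Lemma refines_tail P Q a b : refines P Q -> tail_at P a b -> tail_at Q a b.
Proof. by rewrite /tail_at => PQ /eqP E; rewrite PQ E. Qed.

Lemma refines_directed P Q a b : refines P Q -> directed P a b -> directed Q a b.
Proof.
by move=> PQ /andP[t h]; rewrite /directed (refines_tail PQ t) (refines_arrow PQ h).
Qed.

Lemma all_triplesP (R : V -> V -> V -> bool) x s :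
  reflect (forall i, i.+2 < size s -> R (nth x s i) (nth x s i.+1) (nth x s i.+2))
          (all_triples R s).
Proof.
apply: (iffP idP); elim: s => [|u [|k [|l s]] IH] //=.
  by case/andP=> Rukl /IH H [|i] // lti; apply: H.
by move=> H; rewrite (H 0) //=; apply: IH => i lti; apply: (H i.+1).
Qed.

(** Discriminating paths with nodes numbered from 0: the path is
    [f 0, ..., f n.+1, c], and [f 1, ..., f n] are the colliders that are parents
    of [c].  Prefixes and suffixes of such paths are then again of this form. *)
Definition collider_path P (f : nat -> V) n c : Prop :=
  forall i, i < n -> [/\ arrow_at P (f i) (f i.+1), arrow_at P (f i.+2) (f i.+1)
    & directed P (f i.+1) c].

Lemma collider_path_discriminating P f n c :
    (forall a b, adj P a b = adj P b a) -> 0 < n ->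
    collider_path P f n c -> uniq (rcons (mkseq f n.+2) c) ->
    nonadj P (f 0) c -> adj P (f n.+1) c ->
  exists q, discriminating_path P (f 0) q (f n) (f n.+1) c.
Proof.
case: n => // n adjC _ H U nac ac.
have Ei : iota 1 n.+2 = iota 1 n ++ [:: n.+1; n.+2] by rewrite -{1}addn2 iotaD add1n.
have En : f 0 :: [seq f i | i <- iota 1 n] ++ [:: f n.+1; f n.+2] = mkseq f n.+3.
  by rewrite -[mkseq _ _]/(f 0 :: map f (iota 1 n.+2)) Ei map_cat.
have Es : f 0 :: [seq f i | i <- iota 1 n] ++ [:: f n.+1; f n.+2; c] = rcons (mkseq f n.+3) c.
  by rewrite -En -cats1 /= -catA.
exists [seq f i | i <- iota 1 n]; apply/and5P; split => //.
- by rewrite Es.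
- have Ep : [seq f i | i <- iota 1 n] ++ [:: f n.+1; f n.+2; c] =
      rcons [seq f i | i <- iota 1 n.+2] c.
    by rewrite Ei map_cat -cats1 -catA.
  rewrite Ep rcons_path; apply/andP; split.
    apply/(pathP (f 0)) => i; rewrite size_map size_iota => lti.
    have E j : j < n.+3 -> nth (f 0) (f 0 :: [seq f i | i <- iota 1 n.+2]) j = f j.
      by move=> ltj; rewrite -[_ :: _]/(mkseq f n.+3) nth_mkseq.
    rewrite -[nth _ (map _ _) i]/(nth (f 0) (f 0 :: [seq f i | i <- iota 1 n.+2]) i.+1).
    rewrite !E //; last exact: leqW.
    case: (ltnP i n.+1) => [lt|ge]; first by have [/arrow_adj] := H i lt.
    have -> : i = n.+1 by apply/eqP; rewrite eqn_leq ge andbT -ltnS.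
    by have [_ /arrow_adj] := H n (ltnSn n); rewrite adjC.
  by rewrite last_map Ei last_cat.
- rewrite En; apply/(all_triplesP _ (f 0)) => i; rewrite size_mkseq => lti.
  rewrite !nth_mkseq //; [|exact: ltnW..|exact: leqW (ltnW _)].
  by have [-> ->] := H i lti.
rewrite -cats1.
apply/allP => k; rewrite mem_cat => /orP[/mapP[i]|]; last first.
  by rewrite inE => /eqP->; have [] := H n (ltnSn n).
rewrite mem_iota => /andP[i0 lti] ->; case: i i0 lti => // i _ lti.
by have [] := H i (ltnW lti).
Qed.

Lemma discriminating_collider_path P x q a b c : discriminating_path P x q a b c ->
  exists f n, [/\ collider_path P f n c, 0 < n, uniq (rcons (mkseq f n.+2) c),
    nonadj P (f 0) c & [/\ f 0 = x, f n = a & f n.+1 = b]].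
Proof.
case/and5P => U _ nac T D; pose s := x :: q ++ [:: a; b].
pose f i := nth x s i; exists f, (size q).+1.
have Ef : mkseq f (size q).+3 = s.
  apply: (@eq_from_nth _ x); first by rewrite size_mkseq /= size_cat /= addn2.
  by move=> i; rewrite size_mkseq => lti; rewrite nth_mkseq.
have fa : f (size q).+1 = a by rewrite /f /= nth_cat ltnn subnn.
have fb : f (size q).+2 = b.
  by rewrite /f /= nth_cat ltnNge leqnSn /= subSn // subnn.
split=> //.
  move=> i lti.
  have lt' : i.+2 < size s by rewrite /= size_cat /= addn2.
  have /andP[-> ->] := elimT (all_triplesP _ x _) T i lt'; split=> //.
  move/allP: D; apply; rewrite mem_rcons inE.
  case: (ltnP i (size q)) => [lt|ge].
    by rewrite /f /= nth_cat lt mem_nth ?orbT.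
  have -> : i = size q by apply/eqP; rewrite eqn_leq ge andbT -ltnS.
  by rewrite fa eqxx.
by rewrite Ef /s -cats1 /= -catA.
Qed.

Lemma orient_directedE P b c p : orient_directed P b c p =
  if p == (b, c) then Some Arrow else if p == (c, b) then Some Tail else P p.
Proof. by rewrite !ffunE. Qed.

Lemma orient_bidirectedE P b c p : orient_bidirected P b c p =
  if p == (b, c) then Some Arrow else if p == (c, b) then Some Arrow else P p.
Proof. by rewrite !ffunE. Qed.

Lemma arrow_orient_directed P b c u v : arrow_at (orient_directed P b c) u v ->
  (u = b /\ v = c) \/ arrow_at P u v.
Proof.
rewrite /arrow_at orient_directedE; case: ifP => [/eqP[-> ->] _|_]; first by left.
by case: ifP => // _; right.
Qed.

Lemma arrow_orient_bidirected P b c u v : arrow_at (orient_bidirected P b c) u v ->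
  (u = b /\ v = c) \/ (u = c /\ v = b) \/ arrow_at P u v.
Proof.
rewrite /arrow_at orient_bidirectedE; case: ifP => [/eqP[-> ->] _|_]; first by left.
by case: ifP => [/eqP[-> ->] _|_]; right; [left|right].
Qed.

Lemma arrow_set_arrow P b c u v : arrow_at (set_mark P b c Arrow) u v ->
  (u = b /\ v = c) \/ arrow_at P u v.
Proof.
rewrite /arrow_at ffunE; case: ifP => [/eqP[-> ->] _|_]; first by left.
by right.
Qed.

Lemma tail_orient_directed P b c u v : tail_at (orient_directed P b c) u v ->
  (u = c /\ v = b) \/ tail_at P u v.
Proof.
rewrite /tail_at orient_directedE; case: ifP => // _.
by case: ifP => [/eqP[-> ->]|_]; [left|right].
Qed.

Lemma tail_orient_bidirected P b c u v :
  tail_at (orient_bidirected P b c) u v -> tail_at P u v.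
Proof. by rewrite /tail_at orient_bidirectedE; do 2 case: ifP => // _. Qed.

Lemma tail_set_arrow P b c u v : tail_at (set_mark P b c Arrow) u v -> tail_at P u v.
Proof. by rewrite /tail_at ffunE; case: ifP. Qed.

Lemma directed_orient_directed P b c : b != c -> directed (orient_directed P b c) b c.
Proof.
rewrite /directed /tail_at /arrow_at !orient_directedE !eqxx => bc.
by case: ifP => // /eqP[E]; rewrite E eqxx in bc.
Qed.

End Marks.

(** * Soundness of the orientation rules R0-R4 *)

Section Skeleton.
Variables (V : finType) (G : DMG V) (e : rel V) (S : V -> V -> {set V}).
Hypothesis skel : is_skeleton (IM_sigma G) e.
Hypothesis seps : is_sepset (IM_sigma G) e S.
Implicit Types (a b c x : V).

Local Notation anc := (connect (dir G)).

Lemma skel_neq a b : e a b -> a != b.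
Proof. by case/skel. Qed.

Lemma skel_insep a b : e a b -> inseparable G a b.
Proof. by case/skel. Qed.

Lemma insep_skel a b : a != b -> inseparable G a b -> e a b.
Proof. by move=> ab ns; apply/skel. Qed.

Lemma skel_sym a b : e a b = e b a.
Proof.
by apply/idP/idP => ab; apply: insep_skel; rewrite 1?eq_sym ?(skel_neq ab) //;
  apply: inseparable_sym; rewrite ?(skel_neq ab) //; apply: skel_insep.
Qed.

Lemma skel_sc a b : a != b -> anc a b -> anc b a -> e a b.
Proof. by move=> ab a_b b_a; apply: insep_skel => //; apply: inseparable_sc. Qed.

Lemma skel_sc_trans a b c : e a b -> ~~ anc b a -> anc b c -> anc c b -> e a c.
Proof.
move=> ab ba b_c c_b; apply: insep_skel; first by apply: contraNneq ba => ->.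
by apply: inseparable_sc_trans (skel_neq ab) (skel_insep ab) ba b_c c_b.
Qed.

Lemma sepset_no_walk x c s t : x != c -> ~~ e x c ->
  ~ walk G (through G (S x c)) x s t c.
Proof.
move=> xc exc; have [_ /(_ _ _ xc exc)[/subsetP Zxc sep]] := seps.
by apply: separated_no_walk sep _ _; apply/negP=> /Zxc; rewrite !inE eqxx ?orbT.
Qed.

Lemma skel_open Z a b : e a b -> exists s t,
  [/\ walk G (through G Z) a s t b, ~~ anc a b -> is_head s & ~~ anc b a -> is_head t].
Proof. by move=> ab; apply: inseparable_open (skel_neq ab) (skel_insep ab). Qed.

(** If [b] is an ancestor of [c] outside the separating set, an open walk from [x]
    to [b] can always be continued to [c]: along an inducing walk when [b] is an
    ancestor of the separating set, since then [b] is open in every way, and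
    otherwise along a directed walk. *)
Lemma open_to_ancestor x s t b c : x != c -> ~~ e x c -> e b c ->
  walk G (through G (S x c)) x s t b -> b \notin S x c -> ~~ anc b c.
Proof.
move=> xc nxc bc W bZ; apply/negP=> b_c.
have [bA|bA] := boolP (b \in anS G (S x c)).
  have [s' [t' [W' _ _]]] := skel_open (S x c) bc.
  apply: (sepset_no_walk xc nxc); apply: walk_cat W _ W'.
  by rewrite /through bA bZ; case: ifP.
have [s' [Hs' W']] := walk_outside_anS (skel_neq bc) b_c bA.
apply: (sepset_no_walk xc nxc); apply: walk_cat W _ W'.
by apply: through_noncollider; rewrite // (negbTE Hs') andbF.
Qed.

Lemma open_into_collider x s t b c : x != c -> ~~ e x c -> e b c ->
  walk G (through G (S x c)) x s t b -> is_head t -> b \in anS G (S x c) -> anc b c.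
Proof.
move=> xc nxc bc W Ht bA; apply/negPn/negP=> b_c.
have [s' [t' [W' Hs' _]]] := skel_open (S x c) bc.
apply: (sepset_no_walk xc nxc); apply: walk_cat W _ W'.
by rewrite /through Ht Hs' ?bA.
Qed.

Lemma unshielded_sepset a c b : e a c -> e c b -> a != b -> ~~ e a b ->
  (c \in S a b) = anc c a || anc c b.
Proof.
move=> ac cb ab nab; have [Ssym _] := seps.
have [s [t [W _ Ht]]] := skel_open (S a b) ac.
have [s' [t' [W' _ _]]] := skel_open (S b a) (etrans (skel_sym b c) cb).
apply/idP/idP => [cS|].
  have [//|ca] := boolP (anc c a).
  by rewrite (open_into_collider _ _ cb W (Ht ca)) // sub_anS.
apply: contraTT => cS; rewrite negb_or (open_to_ancestor _ _ cb W cS) // andbT.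
apply: open_to_ancestor W' _; rewrite 1?eq_sym // 1?skel_sym //.
by rewrite Ssym.
Qed.

(** Each collider is an ancestor of the separating set, for otherwise
    [open_to_ancestor] would connect [f 0] to [c].  So the inducing walks along
    the path concatenate to an open walk to the last node, where
    [open_to_ancestor] and [open_into_collider] decide. *)
Lemma discriminating_sepset (f : nat -> V) n c :
    f 0 != c -> ~~ e (f 0) c -> 0 < n -> e (f n.+1) c ->
    (forall i, i < n ->
       [/\ e (f i) (f i.+1) && ~~ anc (f i.+1) (f i),
           e (f i.+2) (f i.+1) && ~~ anc (f i.+1) (f i.+2)
         & e (f i.+1) c && anc (f i.+1) c]) ->
  (f n.+1 \in S (f 0) c) = anc (f n.+1) c.
Proof.
move=> xc nxc n0 bc H'; set Z := S (f 0) c.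
have H i : i < n -> [/\ e (f i) (f i.+1) /\ e (f i.+1) (f i.+2),
    ~~ anc (f i.+1) (f i), ~~ anc (f i.+1) (f i.+2),
    e (f i.+1) c & anc (f i.+1) c].
  by move=> /H'[/andP[? ?] /andP[? ?] /andP[? ?]]; rewrite (skel_sym (f i.+1) (f i.+2)).
have step i : i < n -> (exists s t, walk G (through G Z) (f 0) s t (f i.+1) /\ is_head t) ->
    f i.+1 \in anS G Z.
  move=> ltin [s [t [W Ht]]]; have [_ _ _ ic i_c] := H i ltin.
  have [iZ|iZ] := boolP (f i.+1 \in Z); first exact: sub_anS.
  by case/negP: (open_to_ancestor xc nxc ic W iZ).
have chain i : i < n -> exists s t, walk G (through G Z) (f 0) s t (f i.+1) /\ is_head t.
  elim: i => [|i IH] ltin.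
    have [[ac _] ba _ _ _] := H 0 ltin.
    have [s [t [W _ Ht]]] := skel_open Z ac.
    by exists s, t; rewrite Ht.
  have lt1 := ltnW ltin; have iA := step i lt1 (IH lt1).
  have [[_ ac] _ ab _ _] := H i lt1; have [_ ba _ _ _] := H i.+1 ltin.
  have [s [t [W Ht]]] := IH lt1; have [s' [t' [W' Hs' Ht']]] := skel_open Z ac.
  exists s, t'; split; last exact: Ht'.
  by apply: walk_cat W _ W'; rewrite /through Ht Hs'.
case: n n0 bc H {H'} step chain => // m _ bc H step chain.
have iA := step m (leqnn _) (chain m (leqnn _)).
have [s [t [W Ht]]] := chain m (leqnn _).
have [[_ ac] _ ab _ a_c] := H m (leqnn _).
have [s' [t' [W' Hs' Ht']]] := skel_open Z ac.
have Wb : walk G (through G Z) (f 0) s t' (f m.+2).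
  by apply: walk_cat W _ W'; rewrite /through Ht Hs'.
apply/idP/idP => [bZ|b_c]; last first.
  by apply/negPn/negP=> bZ; case/negP: (open_to_ancestor xc nxc bc Wb bZ).
have [//|b_c] := boolP (anc (f m.+2) c).
rewrite -(negbTE b_c); apply: open_into_collider Wb _ _ => //; last exact: sub_anS.
by apply: Ht'; apply: contra b_c => b_a; apply: connect_trans b_a a_c.
Qed.

Implicit Types (P Q F : marked_graph V).

Definition ancestral P : Prop :=
  [/\ forall a b, adj P a b = e a b, forall a b, arrow_at P a b -> ~~ anc b a
    & forall a b, tail_at P a b -> arrow_at P b a /\ anc b a].

Definition unshielded_oriented P : Prop := forall a c b,
  e a c -> e c b -> a != b -> ~~ e a b -> c \notin S a b -> arrow_at P a c.

(** The effect of R0 is part of the invariant because the later rules use that a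
    surviving circle rules out an unshielded collider. *)
Definition sound P : Prop := ancestral P /\ unshielded_oriented P.

(** Only the truth of the new marks needs checking: a new mark cannot contradict
    an earlier one, since both are true. *)
Lemma sound_update P Q : sound P ->
    (forall a b, Q (a, b) = P (a, b) \/ e a b /\
       (arrow_at Q a b /\ ~~ anc b a \/ [/\ tail_at Q a b, arrow_at Q b a & anc b a])) ->
  refines P Q /\ sound Q.
Proof.
move=> [[Padj Parr Ptail] Puns] H.
have ref : refines P Q.
  move=> [a b] Pab; case: (H a b) => [//|[eab HQ]].
  have := Parr a b; have := Ptail a b; have := Padj a b; move: Pab HQ.
  rewrite /arrow_at /tail_at /adj eab; case: (P (a, b)) => [[]|] //= _.
    by case=> [[_ ba] _ /(_ isT)[_ b_a]|[/eqP-> _ _]//]; rewrite b_a in ba.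
  by case=> [[/eqP->]//|[_ _ b_a] _ _ /(_ isT)]; rewrite b_a.
split=> //; split; last by move=> *; apply: refines_arrow ref _; apply: Puns; eassumption.
split=> a b.
- rewrite -Padj /adj; case: (H a b) => [->//|[eab HQ]].
  have := Padj a b; rewrite eab /adj => ->.
  by case: HQ => [[/eqP-> _]|[/eqP-> _ _]].
- rewrite /arrow_at; case: (H a b) => [-> /Parr//|[_ [[_ //]|[/eqP-> //]]]].
rewrite {1}/tail_at; case: (H a b) => [-> /Ptail[A ->]|[_ [[/eqP->//]|[//]]]].
by split=> //; apply: refines_arrow A.
Qed.

Lemma sound_directed P b c : sound P -> e b c -> anc b c -> ~~ anc c b ->
  refines P (orient_directed P b c) /\ sound (orient_directed P b c).
Proof.
move=> sP bc b_c c_b; have neq := skel_neq bc; apply: sound_update => // x y.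
rewrite orient_directedE; case: eqP => [[-> ->]|_].
  by right; rewrite bc; split=> //; left; rewrite /arrow_at orient_directedE eqxx.
case: eqP => [[-> ->]|_]; last by left.
right; rewrite skel_sym bc; split=> //; right; split=> //.
  rewrite /tail_at orient_directedE eqxx; case: ifP => // /eqP[E _].
  by rewrite E eqxx in neq.
by rewrite /arrow_at orient_directedE eqxx.
Qed.

Lemma sound_bidirected P b c : sound P -> e b c -> ~~ anc b c -> ~~ anc c b ->
  refines P (orient_bidirected P b c) /\ sound (orient_bidirected P b c).
Proof.
move=> sP bc b_c c_b; apply: sound_update => // x y.
rewrite orient_bidirectedE; case: eqP => [[-> ->]|_].
  by right; rewrite bc; split=> //; left; rewrite /arrow_at orient_bidirectedE eqxx.
case: eqP => [[-> ->]|_]; last by left.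
right; rewrite skel_sym bc; split=> //; left; split=> //.
by rewrite /arrow_at orient_bidirectedE eqxx; case: ifP.
Qed.

Lemma sound_arrow P a c : sound P -> e a c -> ~~ anc c a ->
  refines P (set_mark P a c Arrow) /\ sound (set_mark P a c Arrow).
Proof.
move=> sP ac c_a; apply: sound_update => // x y.
rewrite !ffunE; case: eqP => [[-> ->]|_]; last by left.
by right; split=> //; left; rewrite /arrow_at ffunE eqxx.
Qed.

Lemma sound_R0 : sound (R0 S (circle_graph e)).
Proof.
have adj0 a b : adj (circle_graph e) a b = e a b by rewrite /adj ffunE /=; case: (e a b).
have nadj0 a b : nonadj (circle_graph e) a b = (a != b) && ~~ e a b.
  by rewrite /nonadj adj0.
have E0 a c : R0 S (circle_graph e) (a, c) =
    if e a c && [exists b, [&& e c b, (a != b) && ~~ e a b & c \notin S a b]]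
    then Some Arrow else if e a c then Some Circle else None.
  rewrite ffunE adj0; under eq_existsb do rewrite adj0 nadj0.
  by rewrite [X in if _ then _ else X]ffunE.
split; last first.
  move=> a c b ac cb ab nab cS; rewrite /arrow_at E0 ac.
  by case: existsP => // -[]; exists b; rewrite cb ab nab.
split=> a c.
- by rewrite /adj E0; case: (e a c) => //=; case: ifP.
- rewrite /arrow_at E0; case: ifP => [|_]; last by case: ifP.
  case/andP=> ac /existsP[b /and3P[cb /andP[ab nab] cS]] _.
  by move: cS; rewrite unshielded_sepset // negb_or => /andP[].
by rewrite /tail_at E0; case: ifP => // _; case: ifP.
Qed.

Lemma sound_nonadj P a b : sound P -> nonadj P a b = (a != b) && ~~ e a b.
Proof. by case=> -[Padj _ _] _; rewrite /nonadj Padj. Qed.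

Lemma unshielded_noncollider P a b c : sound P ->
  e a c -> e c b -> nonadj P a b -> ~~ arrow_at P a c -> anc c a || anc c b.
Proof.
move=> sP ac cb; rewrite (sound_nonadj _ _ sP) => /andP[ab nab] arr.
rewrite -unshielded_sepset //; apply: contraR arr => cS.
by case: sP => _ /(_ a c b); apply.
Qed.

(** In both cases of R4 the arrowhead at [c] is justified by [a --> c] and the
    arrowhead at [a] from [b]. *)
Lemma sound_R4 P x q a b c : sound P -> discriminating_path P x q a b c ->
  e b c -> [/\ ~~ anc c b, ~~ anc b a || (b \in S x c), e a b
   & (b \in S x c) = anc b c].
Proof.
move=> [[Padj Parr Ptail] Puns] /discriminating_collider_path.
case=> f [[|n] [//H _ _]]; rewrite /nonadj Padj => /andP[xc nxc] [<- <- <-] bc.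
have E : (f n.+2 \in S (f 0) c) = anc (f n.+2) c.
  apply: discriminating_sepset => // i lti.
  have [A1 A2 /andP[/Ptail[A3 ic] _]] := H i lti.
  rewrite -!Padj (arrow_adj A1) (arrow_adj A2) (arrow_adj A3) ic.
  by rewrite (Parr _ _ A1) (Parr _ _ A2).
have [_ A2 /andP[/Ptail[_ ac] _]] := H n (ltnSn n).
have ab := Parr _ _ A2.
split=> //.
- by apply: contra ab; apply: connect_trans ac.
- rewrite E orbC; case: (boolP (anc _ c)) => //= b_c.
  by apply: contra b_c => b_a; apply: connect_trans b_a ac.
by rewrite skel_sym -Padj (arrow_adj A2).
Qed.

Lemma sound_rule P Q : rule_1_4 S P Q -> sound P -> refines P Q /\ sound Q.
Proof.
move=> PQ sP; have [[Padj Parr Ptail] Puns] := sP.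
have circ_e a b : circle_at P a b -> e a b by rewrite -Padj; apply: circle_adj.
have arr_e a b : arrow_at P a b -> e a b by rewrite -Padj; apply: arrow_adj.
have dir_anc a b : directed P a b -> anc a b /\ ~~ anc b a.
  by case/andP => /Ptail[_ ->] /Parr->.
case: PQ => [a b c ab cb nac|a b c H ac|a b c d ab cb ad cd nac db|
             x q a b c D cb bS|x q a b c D cb bS].
- have bc : e b c by rewrite skel_sym circ_e.
  have nca : nonadj P c a by move: nac; rewrite !(sound_nonadj _ _ sP) eq_sym skel_sym.
  have eba : e b a by rewrite skel_sym arr_e.
  have := unshielded_noncollider sP (circ_e _ _ cb) eba nca (circle_not_arrow cb).
  rewrite orbC (negbTE (Parr _ _ ab)) /= => b_c.
  apply: sound_directed => //.
  (* Were [c] an ancestor of [b], it would share its component, and [a] would be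
     adjacent to [c]. *)
  move: nac; rewrite (sound_nonadj _ _ sP) => /andP[_].
  by apply: contra; apply: skel_sc_trans (arr_e _ _ ab) (Parr _ _ ab) b_c.
- apply: sound_arrow => //; first exact: circ_e.
  case/orP: H => /andP[].
    move=> /dir_anc[a_b _] /Parr; apply: contra => c_a; exact: connect_trans a_b.
  move=> /Parr + /dir_anc[b_c _]; apply: contra => c_a; exact: connect_trans c_a.
- apply: sound_arrow => //; first exact: circ_e.
  have edc : e d c by rewrite skel_sym circ_e.
  have := unshielded_noncollider sP (circ_e _ _ ad) edc nac (circle_not_arrow ad).
  case/orP=> d_x; [move: (Parr _ _ ab)|move: (Parr _ _ cb)];
    by apply: contra => b_d; apply: connect_trans d_x.
- have bc : e b c by rewrite skel_sym circ_e.
  have [c_b _ _ E] := sound_R4 sP D bc.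
  by apply: sound_directed => //; rewrite -E.
have bc : e b c by rewrite skel_sym circ_e.
have [c_b b_a ab E] := sound_R4 sP D bc.
rewrite (negbTE bS) orbF in b_a.
have nab : ~~ anc a b.
  have [f [[|n] [H //]]] := discriminating_collider_path D.
  by move=> _ _ _ [_ <- <-]; have [_ /Parr] := H n (ltnSn n).
have [ref1 s1] := sound_bidirected sP ab nab b_a.
have nbc : ~~ anc b c by rewrite -E.
have [ref2 s2] := sound_bidirected s1 bc nbc c_b.
by split=> //; apply: refines_trans ref1 ref2.
Qed.

Lemma phase1_sound P F : exhaustively (rule_1_4 S) P F -> sound P ->
  [/\ refines P F, sound F & forall Q, ~ rule_1_4 S F Q].
Proof.
elim=> {P F} [P ex|P Q F PQ _ IH] sP; first by split.
have [ref sQ] := sound_rule PQ sP; have [ref' sF ex] := IH sQ.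
by split=> //; apply: refines_trans ref ref'.
Qed.

(** * Propagation of arrowheads in a graph closed under R1-R4 *)

Section Closed.
Variable F : marked_graph V.
Hypothesis sF : sound F.
Hypothesis closed : forall Q, ~ rule_1_4 S F Q.

Lemma F_adj a b : adj F a b = e a b.
Proof. by case: sF => -[]. Qed.

Lemma F_adjC a b : adj F a b = adj F b a.
Proof. by rewrite !F_adj skel_sym. Qed.

Lemma F_tail_arrow a b : tail_at F a b -> arrow_at F b a.
Proof. by case: sF => -[_ _ /(_ a b)] T _ /T[]. Qed.

Lemma F_tail_directed a b : tail_at F b a -> directed F a b.
Proof. by move=> t; rewrite /directed t F_tail_arrow. Qed.

Lemma F_arrow_anc a b : arrow_at F a b -> ~~ anc b a.
Proof. by case: sF => -[_ /(_ a b) H _] _ /H. Qed.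

Lemma F_directed_anc a b : directed F a b -> anc a b.
Proof. by case: sF => -[_ _ T] _ /andP[/T[]]. Qed.

Lemma F_not_adj_self a : ~~ adj F a a.
Proof. by rewrite F_adj; apply/negP=> /skel_neq; rewrite eqxx. Qed.

Lemma F_nonadj a b : nonadj F a b -> ~~ adj F a b.
Proof. by case/andP. Qed.

Lemma closed_R1 a b c : arrow_at F a b -> circle_at F c b -> adj F a c.
Proof.
move=> ab cb; case: (boolP (adj F a c)) => // nac; case: (closed (R1 _ ab cb _)).
rewrite /nonadj nac andbT; apply: contraTneq cb => <-; exact: arrow_not_circle.
Qed.

Lemma closed_R2 a b c :
  (directed F a b && arrow_at F b c) || (arrow_at F a b && directed F b c) ->
  adj F a c -> arrow_at F a c.
Proof.
move=> H; rewrite adj_mark => /or3P[//|ac|/F_tail_directed/F_directed_anc c_a].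
  by case: (closed (R2 S H ac)).
case/orP: H => /andP[].
  move=> /F_directed_anc a_b /F_arrow_anc/negP[]; exact: connect_trans c_a a_b.
move=> /F_arrow_anc/negP ba /F_directed_anc b_c; case: ba; exact: connect_trans b_c c_a.
Qed.

Lemma closed_R3 a b c d : arrow_at F a b -> arrow_at F c b ->
  circle_at F a d -> circle_at F c d -> nonadj F a c -> ~~ circle_at F d b.
Proof.
by move=> ab cb ad cd nac; apply/negP => db; apply: closed (R3 _ ab cb ad cd nac db).
Qed.

Lemma closed_R4 f n c : 0 < n -> collider_path F f n c ->
  uniq (rcons (mkseq f n.+2) c) -> nonadj F (f 0) c -> ~~ circle_at F c (f n.+1).
Proof.
move=> n0 H U nac; apply/negP=> cb.
have bc : adj F (f n.+1) c by rewrite F_adjC circle_adj.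
have [q D] := collider_path_discriminating F_adjC n0 H U nac bc.
have [bS|bS] := boolP (f n.+1 \in S (f 0) c).
  exact: closed (R4_directed D cb bS).
exact: closed (R4_bidirected D cb bS).
Qed.

Lemma arrow_or_circle a b c : arrow_at F a b -> circle_at F c b ->
  arrow_at F a c \/ circle_at F a c.
Proof.
move=> ab cb; have := closed_R1 ab cb; rewrite adj_mark.
case/or3P=> [||/F_tail_directed ca]; [by left|by right|].
have c_b : arrow_at F c b.
  by apply: (@closed_R2 c a b); rewrite ?ca ?ab // circle_adj.
by have := arrow_not_circle c_b; rewrite cb.
Qed.

(** The circles are those of the final graph [F], so that this can be proved by
    induction on the rules applied before [F] is reached. *)
Definition pushes P : Prop :=
  forall a b c, arrow_at P a b -> circle_at F c b -> arrow_at F a c.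

(** Suppose [f n] were adjacent to [c].  No arrowhead at an [f i.+1] can come from
    [c], for then [f 0, ..., f i.+1, c, b] would be discriminating for [c], and R4
    would remove the circle at [c].  So each [f i.+1] has a circle or a tail
    towards [c], and going back along the path, the arrowhead at [f i.+1] from
    [f i] yields [f i *-> c]: by hypothesis for a circle and by R2 for a tail.
    For a tail, [f i] is adjacent to [c], as otherwise discriminating paths
    starting at [f i] would remove in turn the circles at all nodes up to
    [f n.+1].  Finally [f 0 *-> c] and R1 contradict the circle at [c] and the
    nonadjacency of [f 0] and [b]. *)
Lemma discriminating_not_adj f n b c : 0 < n -> collider_path F f n b ->
    uniq (rcons (mkseq f n.+2) b) -> nonadj F (f 0) b ->
    (forall i d, i < n -> circle_at F d (f i.+1) -> arrow_at F (f i) d) ->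
    circle_at F b c -> circle_at F c (f n.+1) -> ~~ adj F (f n) c.
Proof.
move=> n0 H U nac push bc cn; apply/negP => adjn.
have fi_c i : i <= n.+1 -> f i != c.
  rewrite leq_eqVlt => /orP[/eqP->|].
    by apply: contraTneq cn => ->; apply: contra (F_not_adj_self c) => /circle_adj.
  case: i => [_|i lti].
    apply: contraTneq bc => <-; apply: contra (F_nonadj nac).
    by move/circle_adj; rewrite F_adjC.
  have [_ _ /andP[ib _]] := H i lti.
  by apply: contraTneq bc => <-; apply: tail_not_circle.
have cb : c != b.
  by apply: contraTneq bc => ->; apply: contra (F_not_adj_self b) => /circle_adj.
have Uf : uniq (mkseq f n.+2) by move: U; rewrite rcons_uniq => /andP[].
have bf : b \notin mkseq f n.+2 by move: U; rewrite rcons_uniq => /andP[].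
have injf i j : i <= n.+1 -> j <= n.+1 -> f i = f j -> i = j.
  move=> lti ltj E; apply/eqP; rewrite -(nth_uniq (f 0) _ _ Uf) ?size_mkseq //.
  by rewrite !nth_mkseq // E.
have bfi i : i <= n.+1 -> f i != b.
  by move=> lti; apply: contraNneq bf => <-; apply: map_f; rewrite mem_iota.
have into_c i : i < n -> ~~ arrow_at F c (f i.+1).
  move=> lti; apply/negP=> ci.
  pose g j := if j <= i.+1 then f j else c.
  suff : ~~ circle_at F b (g i.+2) by rewrite /g ltnn bc.
  apply: closed_R4 => //.
    move=> j ltj; rewrite /g (ltnW ltj) ltj.
    have ltjn : j < n by exact: (@leq_ltn_trans i j n ltj lti).
    have [A1 A2 A3] := H j ltjn; split=> //.
    case: ifP => // ij; suff -> : j = i by [].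
    move: ij; rewrite ltnS => /negbT; rewrite -leqNgt => ij.
    by apply/eqP; rewrite eqn_leq ij andbT.
  have Eg : mkseq g i.+3 = rcons (mkseq f i.+2) c.
    rewrite mkseqS {2}/g ltnn; congr rcons; apply/eq_in_map => j.
    by rewrite mem_iota /g => /andP[_]; rewrite ltnS => ->.
  have lt2 j : j < i.+2 -> j <= n.+1.
    by move=> ltj; apply: leq_trans (leqW lti).
  rewrite Eg !rcons_uniq mem_rcons inE negb_or eq_sym cb andTb; apply/and3P; split.
  - by apply/mapP=> -[j]; rewrite mem_iota => /lt2/bfi/eqP nb E; apply: nb.
  - by apply/mapP=> -[j]; rewrite mem_iota => /lt2/fi_c/eqP nb E; apply: nb.
  by apply/mkseq_uniqP => j k /lt2 ltj /lt2 ltk; apply: injf.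
have step i : i < n -> (forall j, i < j <= n -> adj F (f j) c) -> arrow_at F (f i) c.
  move=> lti adjs; have [Ai _ _] := H i lti.
  have /or3P[] : [|| arrow_at F c (f i.+1), circle_at F c (f i.+1) | tail_at F c (f i.+1)].
    by rewrite -adj_mark F_adjC adjs // ltnSn.
  - by move=> A; case/negP: (into_c i lti).
  - exact: push.
  move=> /F_tail_directed D1.
  have [adji|nadji] := boolP (adj F (f i) c).
    by apply: (@closed_R2 _ (f i.+1)); rewrite ?Ai ?D1 ?orbT.
  have chain K : 0 < K -> i + K <= n ->
      (forall k, k < K -> directed F (f (i + k.+1)) c) -> ~~ circle_at F c (f (i + K).+1).
    move=> K0 leK D; rewrite -addnS; apply: (@closed_R4 (fun k => f (i + k))) => //.
    - move=> k ltk; rewrite !addnS.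
      have ltkn : i + k < n by apply: leq_trans leK; rewrite ltn_add2l.
      by have [-> ->] := H _ ltkn; split=> //; rewrite -addnS; apply: D.
    - rewrite rcons_uniq; apply/andP; split.
        apply/mapP=> -[j]; rewrite mem_iota => /andP[_ ltj] E.
        suff : f (i + j) != c by rewrite E eqxx.
        by apply: fi_c; apply: leq_trans (_ : i + K.+1 <= _); rewrite ?leq_add2l // addnS.
      apply/mkseq_uniqP => j k ltj ltk /injf E; apply/eqP; rewrite -(eqn_add2l i); apply/eqP.
      by apply: E; apply: leq_trans (_ : i + K.+1 <= _); rewrite ?leq_add2l // addnS.
    by rewrite addn0 /nonadj nadji andbT; apply: fi_c; apply: leqW (ltnW lti).
  have dirs K : i + K <= n -> forall k, k < K -> directed F (f (i + k.+1)) c.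
    elim: K => [|K IH] leK k //; rewrite ltnS leq_eqVlt => /orP[/eqP->|]; last first.
      by apply: IH; apply: leq_trans leK; rewrite leq_add2l.
    case: K IH leK => [|K] IH leK; first by rewrite addn1.
    have leK' : i + K.+1 < n by rewrite -addnS.
    have nc := chain K.+1 isT (ltnW leK') (IH (ltnW leK')).
    have : adj F c (f (i + K.+2)).
      by rewrite F_adjC adjs // leK andbT addnS ltnS leq_addr.
    rewrite adj_mark !addnS -addnS (negbTE nc) (negbTE (into_c _ leK')) /=.
    exact: F_tail_directed.
  have := chain (n - i) _ _ (dirs _ _); rewrite subn_gt0 subnKC ?(ltnW lti) // cn.
  by move=> /(_ lti (leqnn _) (leqnn _)).
have all_adj d : d <= n -> forall j, n - d <= j <= n -> adj F (f j) c.
  elim: d => [|d IH] ltd j.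
    by rewrite subn0 -eqn_leq => /eqP<-.
  case/andP=> le1 le2; move: le1; rewrite leq_eqVlt => /orP[/eqP Ej|].
    apply: arrow_adj; rewrite -Ej; apply: step => [|k /andP[lt1 lt2]].
      by rewrite ltn_subrL.
    by apply: IH; rewrite ?(ltnW ltd) // lt2 andbT; rewrite -(subnSK ltd) in lt1 *.
  by move=> lt; apply: IH; rewrite ?(ltnW ltd) // le2 andbT -(subnSK ltd).
have c0 : arrow_at F (f 0) c.
  by apply: step => // j /andP[_ lej]; apply: (all_adj n) => //; rewrite subnn.
by move: (F_nonadj nac); rewrite (closed_R1 c0 bc).
Qed.

(** An arrowhead created by R0 comes with a second one, from a node [d] not
    adjacent to [a].  Both [a] and [d] are adjacent to [c].  If neither had an
    arrowhead at [c], R3 would remove the circle at [b]; if only [d] had one, R1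
    would remove the circle at [c]. *)
Lemma pushes_R0 : refines (R0 S (circle_graph e)) F -> pushes (R0 S (circle_graph e)).
Proof.
move=> ref a b c ab0 cb; have ab := refines_arrow ref ab0.
have [_ uns] := sF.
have [d [bd ad nad bS]] : exists d, [/\ e b d, a != d, ~~ e a d & b \notin S a d].
  have cadj x y : adj (circle_graph e) x y = e x y by rewrite /adj ffunE /=; case: (e x y).
  move: ab0; rewrite /arrow_at ffunE; case: ifP => [|_]; last by rewrite ffunE; case: ifP.
  by case/andP=> _ /existsP[d]; rewrite /nonadj !cadj => /and3P[? /andP[? ?] ?]; exists d.
have Ssym : S a d = S d a by case: seps.
have eab : e a b by rewrite -F_adj arrow_adj.
have db : arrow_at F d b.
  by apply: (uns d b a); rewrite 1?skel_sym // 1?eq_sym // 1?skel_sym // -Ssym.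
case: (arrow_or_circle ab cb) => // ac; case: (arrow_or_circle db cb) => dc.
  have := closed_R1 dc ac; rewrite F_adj skel_sym.
  by rewrite (negbTE nad).
have := closed_R3 ab db ac dc; rewrite /nonadj ad F_adj nad cb.
by move=> /(_ isT).
Qed.

(** The pattern [a *-> z --> b], which justifies the arrowhead at [b] in R2 and
    the arrowhead at [c] in R4.  The edge between [z] and [c] has an arrowhead at
    [c]; its mark at [z] decides how [a *-> c] follows. *)
Lemma pushes_through a z b c : arrow_at F a b ->
    (forall d, circle_at F d z -> arrow_at F a d) -> arrow_at F a z ->
    directed F z b -> (forall d, circle_at F d b -> arrow_at F z d) ->
  circle_at F c b -> arrow_at F a c.
Proof.
move=> ab push_z az zb push_b cb; have zc := push_b _ cb.
have adj_ac := closed_R1 ab cb.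
have : adj F c z by rewrite F_adjC arrow_adj.
rewrite adj_mark => /or3P[cz|/push_z//|/F_tail_directed zc'].
  have c_b : arrow_at F c b.
    by apply: (@closed_R2 c z b); rewrite ?cz ?zb ?orbT // circle_adj.
  by have := arrow_not_circle c_b; rewrite cb.
by apply: (@closed_R2 a z c); rewrite ?az ?zc' ?orbT.
Qed.

Lemma collider_path_refines P Q f n c :
  refines P Q -> collider_path P f n c -> collider_path Q f n c.
Proof.
move=> ref H i /H[A1 A2 D]; split; [exact: refines_arrow A1|exact: refines_arrow A2|].
exact: refines_directed D.
Qed.

(** In most cases the arrowheads among the premises of the rule are older and
    can be pushed themselves, and R1 or R2 carries this over to the new one.  The
    exception is the bidirected case of R4: the arrowhead at the middle node [b]
    from [c] needs [discriminating_not_adj], and the one from [a] then follows by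
    R2 from [a --> c]. *)
Lemma pushes_rule P Q : rule_1_4 S P Q -> sound P -> refines Q F ->
  pushes P -> pushes Q.
Proof.
move=> PQ sP QF push; have [refPQ sQ] := sound_rule PQ sP.
have PF := refines_trans refPQ QF.
have Fnonadj a b : nonadj P a b -> nonadj F a b.
  by rewrite /nonadj F_adj; case: sP => -[-> _ _].
have arr_neq x y : arrow_at F x y -> x != y.
  by move/arrow_adj; rewrite F_adj; apply: skel_neq.
have Pe x y : adj P x y = e x y by case: sP => -[].
case: PQ sQ refPQ QF => [a b c ab cb nac|a b c H ac|a b c d ab cb ad cd nac db|
    x q a b c D cb bS|x q a b c D cb bS] sQ refPQ QF u v w uv.
- have Fuv := refines_arrow QF uv.
  case/arrow_orient_directed: uv => [[E1 E2]|/push]; last exact.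
  rewrite {u}E1 {v}E2 in Fuv *; move=> wc.
  have bc : directed F b c.
    by apply: refines_directed QF _; apply: directed_orient_directed; apply: arr_neq.
  have not_wc : ~~ arrow_at F w c by apply: contraL wc; apply: arrow_not_circle.
  case: (arrow_or_circle Fuv wc) => // bw.
  have : adj F c w by rewrite F_adjC circle_adj.
  rewrite adj_mark => /or3P[cw|cw|/F_tail_arrow wc']; last by rewrite wc' in not_wc.
    by apply: (@closed_R2 b c w); rewrite ?bc ?cw // circle_adj.
  have : adj F w b by rewrite F_adjC circle_adj.
  rewrite adj_mark => /or3P[wb|wb|/F_tail_arrow//].
    by case/negP: not_wc; apply: (@closed_R2 w b c); rewrite ?bc ?wb ?orbT // circle_adj.
  have aw := push _ _ _ ab wb.
  by have := closed_R1 aw cw; rewrite (negbTE (F_nonadj (Fnonadj _ _ nac))).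
- have Fuv := refines_arrow QF uv.
  case/arrow_set_arrow: uv => [[E1 E2]|/push]; last exact.
  rewrite {u}E1 {v}E2 in Fuv *; move=> wc.
  case/orP: H => /andP[].
    move=> /(refines_directed PF) ab bc; have bw := push _ _ _ bc wc.
    by apply: (@closed_R2 a b w); rewrite ?ab ?bw // (closed_R1 Fuv).
  move=> ab bc; apply: (@pushes_through a b c) => //.
  + by move=> d; apply: push.
  + exact: refines_arrow ab.
  + exact: refines_directed bc.
  by move=> d; apply: push; case/andP: bc.
- (* Now [a *-> w <-* c].  R3 excludes a circle at [w] on the edge from [d] while
     both circles at [d] persist.  They cannot both become arrowheads, as [d] is
     an ancestor of [a] or [c]; one arrowhead would trigger R1, and a tail at [d]
     gives [d *-> w] by R2. *)
  have Fuv := refines_arrow QF uv.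
  case/arrow_set_arrow: uv => [[E1 E2]|/push]; last exact.
  rewrite {u}E1 {v}E2 in Fuv *; move=> wb.
  have aw := push _ _ _ ab wb; have cw := push _ _ _ cb wb.
  have adw := closed_R1 Fuv wb.
  have Fed x : circle_at P x d -> adj F d x.
    by move/circle_adj; rewrite Pe -F_adj F_adjC.
  have tail_case x : circle_at P x d -> arrow_at F x w -> arrow_at F d w \/ ~~ tail_at F x d.
    move=> xd xw; case: (boolP (tail_at F x d)) => [/F_tail_directed dx|]; last by right.
    by left; apply: (@closed_R2 d x w); rewrite ?dx ?xw.
  case: (tail_case a ad aw) => // ta; case: (tail_case c cd cw) => // tc.
  have nFac := F_nonadj (Fnonadj _ _ nac).
  have nFca : ~~ adj F c a by rewrite F_adjC.
  case: (arrow_or_circle Fuv wb) => // dw.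
  have := Fed _ ad; rewrite F_adjC adj_mark (negbTE ta) orbF.
  have := Fed _ cd; rewrite F_adjC adj_mark (negbTE tc) orbF.
  case/orP=> [cd'|cd'] /orP[ad'|ad'].
  + have [ead ecd] : e a d /\ e c d by rewrite -!Pe !circle_adj.
    rewrite (skel_sym c d) in ecd.
    have := unshielded_noncollider sP ead ecd nac (circle_not_arrow ad).
    by rewrite (negbTE (F_arrow_anc ad')) (negbTE (F_arrow_anc cd')).
  + by have := closed_R1 cd' ad'; rewrite (negbTE nFca).
  + by have := closed_R1 ad' cd'; rewrite (negbTE nFac).
  have := closed_R3 aw cw ad' cd' (Fnonadj _ _ nac).
  by rewrite dw.
- have Fuv := refines_arrow QF uv.
  case/arrow_orient_directed: uv => [[E1 E2]|/push]; last exact.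
  rewrite {u}E1 {v}E2 in Fuv *.
  have [f [[|n] [H //]]] := discriminating_collider_path D.
  move=> _ _ _ [_ Ea Eb]; have [_ A2 Dc] := H n (ltnSn n).
  rewrite Ea Eb in A2 Dc; apply: (@pushes_through b a c) => //.
  + by move=> d; apply: push.
  + exact: refines_arrow A2.
  + exact: refines_directed Dc.
  by move=> d; apply: push; case/andP: Dc.
have Fuv := refines_arrow QF uv.
have [f [[|n] [H //]]] := discriminating_collider_path D.
move=> _ U nf [_ Ea Eb]; have [_ A2 Dc] := H n (ltnSn n).
have Q_cb : arrow_at F c b.
  apply: refines_arrow QF _.
  by rewrite /arrow_at orient_bidirectedE eqxx; case: ifP.
have Q_ab : arrow_at F a b.
  by apply: refines_arrow QF _; rewrite /arrow_at !orient_bidirectedE eqxx; do !case: ifP.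
have push_cb d : circle_at F d b -> arrow_at F c d.
  move=> db; case: (arrow_or_circle Q_cb db) => // cd; rewrite -Eb in db.
  have HF := collider_path_refines PF H.
  have adj_ad : adj F (f n.+1) d.
    by rewrite Ea; apply: closed_R1 Q_ab _; rewrite -Eb.
  suff : ~~ adj F (f n.+1) d by rewrite adj_ad.
  apply: (@discriminating_not_adj f n.+1 c d isT HF U (Fnonadj _ _ nf) _ cd db).
  by move=> i y lti; apply: push; have [] := H i lti.
case/arrow_orient_bidirected: uv => [[E1 E2]|[[E1 E2]|]].
- rewrite {u}E1 {v}E2 in Fuv *.
  rewrite Ea Eb in A2 Dc; apply: (@pushes_through b a c) => //.
  + by move=> d; apply: push.
  + exact: refines_arrow A2.
  + exact: refines_directed Dc.
  by move=> d; apply: push; case/andP: Dc.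
- by rewrite E1 E2; apply: push_cb.
case/arrow_orient_bidirected => [[E1 E2]|[[E1 E2]|/push]]; last exact.
- rewrite {u}E1 {v}E2 in Fuv *; move=> wb.
  have ac := refines_directed PF Dc; rewrite Ea in ac.
  by apply: (@closed_R2 a c w); rewrite ?ac ?push_cb // (closed_R1 Fuv).
by rewrite E1 E2 -Ea; apply: push; rewrite -Eb.
Qed.

Lemma phase1_invariant (K : marked_graph V -> Prop) P F' :
    exhaustively (rule_1_4 S) P F' -> sound P ->
    (forall P Q, rule_1_4 S P Q -> sound P -> refines Q F' -> K P -> K Q) ->
  K P -> K F'.
Proof.
elim=> {P F'} [//|P Q F' PQ QF IH] sP step KP.
have [_ sQ] := sound_rule PQ sP; apply: IH => //.
by apply: step KP => //; have [] := phase1_sound QF sQ.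
Qed.

Hypothesis reach : exhaustively (rule_1_4 S) (R0 S (circle_graph e)) F.

Lemma pushes_F : pushes F.
Proof.
apply: phase1_invariant reach sound_R0 _ _ => [P Q|].
  by move=> PQ sP QF; apply: pushes_rule PQ sP QF.
by apply: pushes_R0; have [] := phase1_sound reach sound_R0.
Qed.

(** * Rules R8a, R9 and R10 *)

(** In all graphs of the second phase the possibly directed edges are the same,
    see [adds_tails_pd]. *)
Definition pd_F a b : bool := adj F a b && ~~ arrow_at F b a.
Definition uncovered_F (s : seq V) : bool := all_triples (fun u _ l => nonadj F u l) s.

Definition adds_tails Q : Prop := forall a b,
  Q (a, b) = F (a, b) \/ [/\ circle_at F a b, tail_at Q a b & arrow_at F b a].

Lemma adds_tails_arrow Q a b : adds_tails Q -> arrow_at Q a b = arrow_at F a b.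
Proof.
rewrite /arrow_at => H; case: (H a b) => [->//|[/eqP-> t _]].
by move: t; rewrite /tail_at => /eqP->.
Qed.

Lemma adds_tails_adj Q a b : adds_tails Q -> adj Q a b = adj F a b.
Proof.
rewrite /adj => H; case: (H a b) => [->//|[/eqP-> t _]].
by move: t; rewrite /tail_at => /eqP->.
Qed.

Lemma adds_tails_circle Q a b : adds_tails Q -> circle_at Q a b -> circle_at F a b.
Proof. by rewrite /circle_at => H; case: (H a b) => [->//|[/eqP->]]. Qed.

Lemma adds_tails_tail Q a b : adds_tails Q -> tail_at Q a b -> arrow_at F b a.
Proof.
rewrite {1}/tail_at => H; case: (H a b) => [->|[]//]; exact: F_tail_arrow.
Qed.

Lemma adds_tails_pd Q a b : adds_tails Q -> pd_edge Q a b = pd_F a b.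
Proof.
move=> H; rewrite /pd_edge /pd_F /circle_circle /circle_arrow /directed.
rewrite -(adds_tails_adj _ _ H) -(adds_tails_arrow _ _ H).
have adjC : adj Q a b = adj Q b a by rewrite !adds_tails_adj // F_adjC.
have tba := @adds_tails_tail Q b a H; have tab := @adds_tails_tail Q a b H.
rewrite -(adds_tails_arrow _ _ H) in tba; rewrite -(adds_tails_arrow _ _ H) in tab.
move: adjC tba tab; rewrite /adj /circle_at /arrow_at /tail_at.
by case: (Q (a, b)) => [[]|]; case: (Q (b, a)) => [[]|] //= _ T T';
  try (by have := T isT); try (by have := T' isT).
Qed.

Lemma all_triples_ext (R R' : V -> V -> V -> bool) s :
  (forall a b c, R a b c = R' a b c) -> all_triples R s = all_triples R' s.
Proof.
by move=> E; elim: s => [|u [|k [|l s]] IH] //=; rewrite E; congr (_ && _).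
Qed.

Lemma adds_tails_uncovered Q a s : adds_tails Q ->
  uncovered_pd_path Q a s = [&& uniq (a :: s), path pd_F a s & uncovered_F (a :: s)].
Proof.
move=> H; rewrite /uncovered_pd_path; congr [&& _, _ & _].
  by apply: eq_path => x y; apply: adds_tails_pd.
by apply: all_triples_ext => x _ y; rewrite /nonadj adds_tails_adj.
Qed.

Lemma adds_tails_F : adds_tails F. Proof. by left. Qed.

Lemma adds_tails_orient Q a c : adds_tails Q -> circle_arrow Q a c ->
  refines Q (orient_directed Q a c) /\ adds_tails (orient_directed Q a c).
Proof.
move=> H /andP[ca ac]; have Fac := ac; rewrite (adds_tails_arrow _ _ H) in Fac.
have neq : a != c by apply: skel_neq; rewrite -F_adj arrow_adj.
have ref : refines Q (orient_directed Q a c).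
  move=> p np; rewrite orient_directedE; case: eqP => [E|_]; first by rewrite E; apply/esym/eqP.
  by case: eqP => // E; move: np ca; rewrite E /circle_at => /negbTE->.
split=> // u v; rewrite orient_directedE; case: eqP => [[-> ->]|_].
  by left; apply/esym/eqP.
case: eqP => [[-> ->]|_]; last first.
  case: (H u v) => [|[A B C]]; [by left|right]; split=> //; exact: refines_tail ref B.
right; split=> //; first exact: adds_tails_circle ca.
by case/andP: (directed_orient_directed Q neq).
Qed.

Lemma rule_8_10_orient P Q : rule_8_10 P Q ->
  exists a c, circle_arrow P a c /\ Q = orient_directed P a c.
Proof. by case=> *; do 2 eexists; split; eauto. Qed.

Lemma phase2_adds_tails Q P : exhaustively (@rule_8_10 V) Q P -> adds_tails Q ->
  [/\ refines Q P, adds_tails P & forall Q', ~ rule_8_10 P Q'].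
Proof.
elim=> {Q P} [P ex|P Q P' PQ _ IH] tP; first by split.
have [a [c [ac EQ]]] := rule_8_10_orient PQ.
have [ref tQ] := adds_tails_orient tP ac; rewrite -EQ in ref tQ.
by have [ref' tP' ex] := IH tQ; split=> //; apply: refines_trans ref ref'.
Qed.

Section CircleEdge.
Variables i j : V.
Hypothesis ij : circle_at F i j.
Hypothesis ji : circle_at F j i.

(** If R1 oriented [k --> i] because of [a *-> k], then [k o-> j] would give
    [a *-> j], and R1 would orient the edge between [j] and [i].  For R4 the
    discriminating path is the one excluded by [discriminating_not_adj]. *)
Lemma tail_excludes_circle k : tail_at F i k -> ~~ circle_at F j k.
Proof.
pose K P := forall k, tail_at P i k -> ~~ circle_at F j k.
move: k; apply: (@phase1_invariant K _ _ reach sound_R0) => [P Q|]; last first.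
  by move=> k; rewrite /tail_at !ffunE; do 2 case: ifP => // _.
move=> PQ sP QF KP; have [refPQ _] := sound_rule PQ sP; have PF := refines_trans refPQ QF.
have Fnonadj a b : nonadj P a b -> ~~ adj F a b.
  by case/andP=> _; rewrite F_adj; case: sP => -[-> _ _].
case: PQ {refPQ QF} => [a b c ab cb nac|a b c H ac|a b c d ab cb ad cd nac db|
    x q a b c D cb bS|x q a b c D cb bS] k.
- case/tail_orient_directed=> [[ic kb]|/KP//].
  apply/negP=> jk; have := Fnonadj _ _ nac; rewrite -ic.
  rewrite (@closed_R1 a j i) //; apply: pushes_F jk; rewrite kb.
  exact: refines_arrow ab.
- by move/tail_set_arrow/KP.
- by move/tail_set_arrow/KP.
- case/tail_orient_directed=> [[ic kb]|/KP//].
  apply/negP=> jk.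
  have [f [n [H n0 U nf [_ Ea Eb]]]] := discriminating_collider_path D.
  have HF := collider_path_refines PF H.
  rewrite -ic in HF U nf; rewrite kb -Eb in jk.
  have nfF : nonadj F (f 0) i by case/andP: (nf) => ne _; rewrite /nonadj ne Fnonadj.
  have : ~~ adj F (f n) j.
    apply: (@discriminating_not_adj f n i j n0 HF U nfF _ ij jk).
    by move=> l y ltl; apply: pushes_F; have [] := HF l ltl.
  case: n n0 HF {H U Ea Eb jk} => // n _ HF; rewrite arrow_adj //.
  by apply: pushes_F ji; have [_ _ /andP[]] := HF n (ltnSn n).
by move/tail_orient_bidirected/tail_orient_bidirected/KP.
Qed.

(** After an arrowhead, R1 orients an uncovered possibly directed path to its
    end; [y] is the last node but one. *)
Lemma uncovered_arrow s v l : arrow_at F v l -> uncovered_F [:: v, l & s] ->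
    path pd_F l s -> exists y,
  [/\ arrow_at F y (last l s), anc l (last l s) & s = [::] \/ anc l y].
Proof.
elim: s v l => [|m s IH] v l vl /=.
  by exists v; split; rewrite ?connect0 //; left.
case/andP=> nvm U /andP[/andP[lm nml] pd].
have : adj F m l by rewrite F_adjC.
rewrite adj_mark (negbTE nml) /= => /orP[ml|/F_tail_directed dlm].
  by have := closed_R1 vl ml; rewrite (negbTE (F_nonadj nvm)).
have [y [A1 A2 A3]] := IH _ _ (proj2 (andP dlm)) U pd.
have l_m := F_directed_anc dlm.
have l_last := connect_trans l_m A2.
case: A3 => [E|m_y].
  by exists l; split=> //; [rewrite E; case/andP: dlm|right].
by exists y; split=> //; right; apply: connect_trans m_y.
Qed.

Hypothesis i_j : anc i j.

(** An arrowhead from [j] would be pushed along the path up to [i], or else turn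
    the rest of the path into a directed one, making the node an ancestor of [i]
    and so of [j]. *)
Lemma no_arrow_on_pd_path s v : path pd_F v s -> uncovered_F (v :: s) ->
  last v s = i -> ~~ arrow_at F j v.
Proof.
elim: s v => [|l s IH] v /=; first by move=> _ _ ->; apply: contraL ji; apply: arrow_not_circle.
move=> /andP[/andP[vl nlv] pd] U El; apply/negP=> jv.
have U' : uncovered_F (l :: s) by move: U => /andP[].
have nj := IH l pd U' El; have : adj F l v by rewrite F_adjC.
rewrite adj_mark (negbTE nlv) /= => /orP[lv|/F_tail_directed dvl].
  by rewrite (pushes_F jv lv) in nj.
have [adjl|nadjl] := boolP (adj F j l).
  by rewrite (@closed_R2 j v l) ?jv ?dvl ?orbT in nj.
have [y [_ A _]] := uncovered_arrow (proj2 (andP dvl)) U pd.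
case/negP: (F_arrow_anc jv); apply: connect_trans (F_directed_anc dvl) _.
by apply: connect_trans A _; rewrite El.
Qed.

(** The path is left at the first node adjacent to [j], which keeps it
    uncovered. *)
Lemma reroute_pd_path s v : path pd_F v s -> uncovered_F (v :: s) ->
    last v s = i -> nonadj F v j -> exists m,
  [/\ path pd_F v (rcons (take m.+1 s) j),
      uncovered_F (v :: rcons (take m.+1 s) j) & j \notin take m.+1 s].
Proof.
elim: s v => [|l s IH] v /=.
  by move=> _ _ -> /F_nonadj; rewrite circle_adj.
move=> /andP[vl pd] U El nvj.
have U' : uncovered_F (l :: s) by move: U => /andP[].
have lj : l != j.
  by apply: contraNneq (F_nonadj nvj) => <-; case/andP: vl.
have [adjl|nadjl] := boolP (adj F l j).
  exists 0; rewrite /= take0 /uncovered_F /= inE eq_sym lj nvj vl.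
  by rewrite /pd_F adjl (no_arrow_on_pd_path pd U' El).
have [|m [A1 A2 A3]] := IH l pd U' El; first by rewrite /nonadj lj.
exists m.+1; split; first by rewrite /= vl A1.
  case: s IH pd U {U' El A1 A3} A2 => [|l' s] IH pd U A2; first by rewrite /uncovered_F /= nvj.
  by move: U A2; rewrite /uncovered_F /= => /andP[-> _] ->.
by rewrite inE negb_or eq_sym lj.
Qed.

Variable P : marked_graph V.
Hypothesis tP : adds_tails P.
Hypothesis closedP : forall Q, ~ rule_8_10 P Q.

Lemma not_arrow_back k : circle_at F i k || tail_at F i k -> ~~ arrow_at F j k.
Proof.
move=> ik; apply/negP=> jk; have : ~~ arrow_at F j i.
  by apply: contraL ji; apply: arrow_not_circle.
case/orP: ik => [ik|/F_tail_directed ki]; first by rewrite (pushes_F jk ik).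
by rewrite (@closed_R2 j k i) ?jk ?ki ?orbT // circle_adj.
Qed.

Lemma directed_or_circle_arrow k : arrow_at F k i -> circle_at F i k || tail_at F i k ->
  directed P k j \/ circle_arrow P k j.
Proof.
move=> ki ik; have kj := pushes_F ki ji.
have : adj P j k by rewrite adds_tails_adj // F_adjC arrow_adj.
rewrite adj_mark /directed /circle_arrow !(adds_tails_arrow _ _ tP) kj !andbT.
by rewrite (negbTE (not_arrow_back ik)) /= => /orP[]; [right|left].
Qed.

(** The rerouted path lets R9 orient [k o-> j], provided that [b] is not adjacent
    to [j].  If it is, then [b o-* j] and [k *-> b], so the path is directed from
    [b] on; the arrowhead at its end is pushed to [j] and back to [b], which
    contradicts that [b] is an ancestor of all later nodes. *)
Lemma no_circle_arrow_R9 Q k b s : adds_tails Q -> circle_arrow Q k i ->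
  uncovered_pd_path Q k (b :: s) -> last b s = i -> nonadj Q b i -> ~~ circle_arrow P k j.
Proof.
move=> tQ /andP[_ ki] U El nbi; apply/negP=> kj.
rewrite (adds_tails_arrow _ _ tQ) in ki.
have {}nbi : b != i /\ ~~ adj F b i by move: nbi; rewrite /nonadj adds_tails_adj // => /andP.
move: U; rewrite adds_tails_uncovered // => /and3P[U pdk unc].
have [kb pd] := andP pdk.
have unc_b : uncovered_F (b :: s).
  by move: unc; rewrite /uncovered_F /=; case: (s) => //= ? ? /andP[].
have s_nil : s <> [::] by move=> E; move: El nbi; rewrite E /= => -> []; rewrite eqxx.
have neq_bj : b != j.
  by apply/eqP=> E; case: nbi => _; rewrite E circle_adj.
have no_jb := no_arrow_on_pd_path pd unc_b El.
have arr_kj := pushes_F ki ji.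
have [adj_bj|nadj_bj] := boolP (adj F b j).
  have circ_bj : circle_at F b j.
    move: adj_bj; rewrite adj_mark => /or3P[bj|//|/F_tail_arrow jb]; last by rewrite jb in no_jb.
    by case: nbi => _; rewrite (closed_R1 bj ij).
  have arr_kb := pushes_F arr_kj circ_bj.
  have [y [yi _ [//|b_y]]] := uncovered_arrow arr_kb unc pd.
  rewrite El in yi; have yb := pushes_F (pushes_F yi ji) circ_bj.
  by case/negP: (F_arrow_anc yb).
have nbj : nonadj F b j by rewrite /nonadj neq_bj nadj_bj.
have [m [pd' unc' jm]] := reroute_pd_path pd unc_b El nbj.
set s' := rcons _ j in pd' unc'.
apply: closedP (@R9 _ P k b j s' kj _ _ _).
- rewrite adds_tails_uncovered //; apply/and3P; split.
  + have Ut := take_uniq m.+3 U.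
    suff: uniq (rcons [:: k, b & take m.+1 s] j) by [].
    rewrite rcons_uniq; apply/andP; split; last exact: Ut.
    rewrite !inE !negb_or jm andbT eq_sym skel_neq -?F_adj ?arrow_adj //=.
    by rewrite eq_sym.
  + by rewrite /= kb.
  + move: unc unc'; rewrite /s' /uncovered_F; case: (s) s_nil => // l s0 _ /=.
    by case/andP=> -> _.
- by rewrite last_rcons.
by rewrite /nonadj adds_tails_adj.
Qed.

(** By induction on the order in which the second phase adds tails.  R8a and R10
    carry over from [i] to [j] because the directed edges into [i] among their
    premises are older and have directed counterparts into [j]. *)
Lemma directed_neighbour k : exhaustively (@rule_8_10 V) F P ->
  directed P k i -> directed P k j.
Proof.
move=> FP.
suff G0 Q P' : exhaustively (@rule_8_10 V) Q P' -> adds_tails Q -> P' = P ->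
    (forall k, directed Q k i -> directed P k j) ->
    forall k, directed P' k i -> directed P k j.
  apply: (G0 F P FP adds_tails_F erefl) => {}k /andP[ik ki].
  have ik' : circle_at F i k || tail_at F i k by rewrite ik orbT.
  case: (directed_or_circle_arrow ki ik') => // /andP[kj _].
  by have := tail_excludes_circle ik; rewrite (adds_tails_circle tP kj).
elim=> {Q P'} [P' _ _ _ H|Q Q' P' QQ' Q'P' IH tQ EP H]; first exact: H.
have [a [c [ac EQ]]] := rule_8_10_orient QQ'.
have [_ tQ'] := adds_tails_orient tQ ac; rewrite -EQ in tQ'.
have [refQ'P _ _] := phase2_adds_tails Q'P' tQ'.
have claim x y l : circle_arrow Q x y -> directed (orient_directed Q x y) l i ->
    (l = x -> i = y -> ~~ circle_arrow P l j) -> directed P l j.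
  move=> xy /andP[il li] nlj; have [_ tQxy] := adds_tails_orient tQ xy.
  have Fli := li; rewrite (adds_tails_arrow _ _ tQxy) in Fli.
  have old : tail_at Q i l -> directed P l j.
    by move=> tl; apply: H; rewrite /directed tl (adds_tails_arrow _ _ tQ).
  case/tail_orient_directed: (il) => [[Ei El]|/old//].
  have il' : circle_at F i l || tail_at F i l.
    move: il; rewrite {1}/tail_at; case: (tQxy i l) => [->|[->]//].
    by rewrite /tail_at => ->; rewrite orbT.
  by case: (directed_or_circle_arrow Fli il') => // lj; move: (nlj El Ei); rewrite lj.
have Qpath l s : uncovered_pd_path Q l s -> uncovered_pd_path P l s.
  by rewrite !adds_tails_uncovered.
have [ref _] := adds_tails_orient tQ ac; rewrite -EQ in ref.
have {refQ'P} refQP := refines_trans ref refQ'P.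
rewrite EP in refQP.
apply: IH => // l; case: QQ' {EQ Q'P' tQ' ref a c ac} => [a b c ab bc ac|
    a b c s ac U El nbc|a b c d m1 m2 s1 s2 ac bc dc U1 E1 U2 E2 nm] li.
- apply: (claim _ _ _ ac li) => Ea Ec; apply/negP=> lj.
  apply: closedP (@R8a _ P l b j _ _ lj).
    by rewrite Ea; apply: refines_directed refQP ab.
  by apply: H; rewrite Ec.
- apply: (claim _ _ _ ac li) => Ea Ec.
  by rewrite -Ea -Ec in ac U El nbc; apply: no_circle_arrow_R9 tQ ac U El nbc.
apply: (claim _ _ _ ac li) => Ea Ec; apply/negP=> lj.
rewrite -Ea -Ec in bc dc U1 U2.
apply: closedP (R10 lj (H _ bc) (H _ dc) (Qpath _ _ U1) E1 (Qpath _ _ U2) E2 _).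
by move: nm; rewrite /nonadj !adds_tails_adj.
Qed.

End CircleEdge.

Lemma circle_of_cycle i j : i != j -> anc i j -> anc j i -> circle_at F i j.
Proof.
move=> ij i_j j_i; have : adj F i j by rewrite F_adj skel_sc.
rewrite adj_mark => /or3P[/F_arrow_anc|//|/F_tail_arrow/F_arrow_anc].
  by rewrite j_i.
by rewrite i_j.
Qed.

Lemma marks_transfer P i j k : adds_tails P -> exhaustively (@rule_8_10 V) F P ->
    i != j -> anc i j -> anc j i ->
  [/\ directed P k i -> directed P k j, bidirected P k i -> bidirected P k j
    & arrow_at P k i -> arrow_at P k j].
Proof.
move=> tP FP neq i_j j_i.
have ij := circle_of_cycle neq i_j j_i.
have ji : circle_at F j i by apply: circle_of_cycle; rewrite 1?eq_sym.
have [_ _ exP] := phase2_adds_tails FP adds_tails_F.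
have arr : arrow_at P k i -> arrow_at P k j.
  by rewrite !(adds_tails_arrow _ _ tP) => ki; apply: pushes_F ki ji.
split=> //; first exact: directed_neighbour.
case/andP=> ik /arr kj; rewrite /bidirected kj andbT.
move: ik; rewrite !(adds_tails_arrow _ _ tP) in kj * => ik.
have : adj F j k by rewrite F_adjC arrow_adj.
rewrite adj_mark => /orP[//|/(not_arrow_back ij)].
by rewrite ik.
Qed.

End Closed.
End Skeleton.

Theorem proposition9 (V : finType) (G : DMG V) (P : marked_graph V)
    (hP : FCI_output (IM_sigma G) P) (i j : V) (hij : i <> j)
    (hsc : j \in sc G i) :
  circle_circle P i j /\
  forall k : V,
    [/\ directed P k i <-> directed P k j,
        bidirected P k i <-> bidirected P k j
      & circle_arrow P k i <-> circle_arrow P k j].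
Proof.
have [e [S [F [skel seps ph1 ph2]]]] := hP.
move: hsc; rewrite in_sc => /andP[j_i i_j].
have ij : i != j by apply/eqP.
have ji : j != i by rewrite eq_sym.
have [_ sF exF] := phase1_sound skel seps ph1 (sound_R0 skel seps).
have [ref tP exP] := phase2_adds_tails skel sF ph2 (adds_tails_F F).
have marks k := marks_transfer skel seps sF exF ph1 k tP ph2 ij i_j j_i.
have marks' k := marks_transfer skel seps sF exF ph1 k tP ph2 ji j_i i_j.
have circ x y : x != y -> connect (dir G) x y -> connect (dir G) y x -> circle_at P x y.
  move=> xy x_y y_x; have := circle_of_cycle skel sF xy x_y y_x.
  case: (tP x y) => [|[_ _ A]]; first by rewrite /circle_at => ->.
  by case: sF => -[_ /(_ _ _ A)]; rewrite x_y.
split; first by rewrite /circle_circle !circ.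
have mark_cases k x : circle_arrow P k x <->
    [/\ arrow_at P k x, ~ directed P k x & ~ bidirected P k x].
  have := adds_tails_adj k x tP; rewrite (F_adjC skel sF) -(adds_tails_adj x k tP) => adjC.
  rewrite /circle_arrow /directed /bidirected; split.
    case/andP=> c a; rewrite a !andbT; split=> //.
      by move/tail_not_circle; rewrite c.
    by move/arrow_not_circle; rewrite c.
  case=> a; rewrite a !andbT => /negP nt /negP na.
  by move: (arrow_adj a); rewrite adjC adj_mark (negbTE nt) (negbTE na) orbF.
move=> k; have [d b a] := marks k; have [d' b' a'] := marks' k; split; try by split.
by split=> /mark_cases[A D B]; apply/mark_cases; split; auto.
Qed.
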